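(* For a finite connected simplicial graph $\Gamma$ of girth at least $6$, the action of $A(\Gamma)$ on $\Gamma^e$ satisfies the $\kappa$-finiteness property for some positive integer $\kappa=\kappa(\Gamma)$. Furthermore, the effective value for $\kappa$ is bounded above by the maximum degree of $\Gamma$; that is, every loxodromic element of $A(\Gamma)$ has an axial subgraph whose width is at most the maximum degree of $\Gamma$.
   Context: For a finite connected simplicial graph $\Gamma$, $A(\Gamma)=\langle v\in V(\Gamma)\mid [u,v]=1 \text{ for all } \{u,v\}\in E(\Gamma)\rangle$ is its right-angled Artin group. For $x,h\in A(\Gamma)$ write $x^h=h^{-1}xh$. The extension graph $\Gamma^e$ is the simplicial graph with vertex set $\{v^g\mid v\in V(\Gamma), g\in A(\Gamma)\}\subset A(\Gamma)$, where two distinct vertices are joined by an edge exactly when they commute in $A(\Gamma)$. It carries the edge metric $d_{\Gamma^e}$ and is $\delta$-hyperbolic. $A(\Gamma)$ acts on $\Gamma^e$ on the right by conjugation, $x\mapsto x^g$. An element $g$ is loxodromic if $\tau(g)=\lim_{n\to\infty} d_{\Gamma^e}(x,x^{g^n})/n>0$ (independent of the vertex $x$). A subgraph $\mathcal{H}\subseteq\Gamma^e$ is weakly convex if the inclusion $(\mathcal{H},d_{\mathcal{H}})\hookrightarrow(\Gamma^e,d_{\Gamma^e})$ is an isometric embedding, where $d_{\mathcal{H}}$ is the edge metric of $\mathcal{H}$. For a loxodromic $g$, an axial subgraph of $g$ is a nonempty weakly convex, locally finite subgraph $\mathcal{A}_g$ that is preserved by $g$ and on which the induced action of $\langle g\rangle$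 is cocompact. Such $\mathcal{A}_g$ is quasi-isometric to a line and so has exactly two ends; a finite set $S$ of vertices of $\mathcal{A}_g$ is end-separating if the two ends lie in different components of $\mathcal{A}_g-S$. The width of $\mathcal{A}_g$ is the minimum cardinality of an end-separating set. The action has the $\kappa$-finiteness property if every loxodromic element has an axial subgraph of width at most $\kappa$. The maximum degree of $\Gamma$ is the maximum number of edges incident to a vertex. The girth is the minimum length of an embedded cycle (infinite if there are no cycles). *)

(* Defs.v *)
From HB Require Import structures.
From mathcomp Require Import all_boot all_order all_algebra generic_quotient.
From mathcomp Require Import all_classical all_reals all_analysis.

Set Implicit Arguments.
Unset Strict Implicit.
Unset Printing Implicit Defensive.

Local Open Scope classical_set_scope.
Local Open Scope quotient_scope.
Local Open Scope group_scope.

Section Raag.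
Context (V : finType) (e : rel V).

(* The letter [(v, true)] stands for [v] and [(v, false)] for [v^-1]. *)
Definition word := seq (V * bool).

Definition winv (w : word) : word := rev [seq (a.1, ~~ a.2) | a <- w].

(* The congruence on words presenting
   <v in V | u^-1 v^-1 u v = 1 for every edge {u, v}>. *)
Inductive word_eq : word -> word -> Prop :=
| word_eq_refl w : word_eq w w
| word_eq_sym w1 w2 : word_eq w1 w2 -> word_eq w2 w1
| word_eq_trans w1 w2 w3 : word_eq w1 w2 -> word_eq w2 w3 -> word_eq w1 w3
| word_eq_cat w1 w1' w2 w2' :
    word_eq w1 w1' -> word_eq w2 w2' -> word_eq (w1 ++ w2) (w1' ++ w2')
| word_eq_cancel v b : word_eq [:: (v, b); (v, ~~ b)] [::]
| word_eq_comm u v : e u v ->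
    word_eq [:: (u, false); (v, false); (u, true); (v, true)] [::].

Definition word_eqb : rel word := fun w1 w2 => `[< word_eq w1 w2 >].

Lemma word_eqb_refl : reflexive word_eqb.
Proof. by move=> w; apply/asboolP/word_eq_refl. Qed.

Lemma word_eqb_sym : symmetric word_eqb.
Proof. by move=> w1 w2; apply/asboolP/asboolP => /word_eq_sym. Qed.

Lemma word_eqb_trans : transitive word_eqb.
Proof.
move=> w2 w1 w3 /asboolP h12 /asboolP h23; apply/asboolP.
exact: word_eq_trans h12 h23.
Qed.

Canonical word_equiv := EquivRel word_eqb word_eqb_refl word_eqb_sym word_eqb_trans.

Definition raag := {eq_quot word_equiv}.

HB.instance Definition _ := Choice.on raag.
HB.instance Definition _ := Quotient.on raag.
HB.instance Definition _ := EqQuotient.on raag.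

Lemma raag_eqP w1 w2 : (\pi_raag w1 = \pi_raag w2) <-> word_eq w1 w2.
Proof. by split => [/eqmodP/asboolP|h]; last exact/eqmodP/asboolP. Qed.

Lemma word_eq_catV w : word_eq (w ++ winv w) [::].
Proof.
elim: w => [|[v b] w IH]; first exact: word_eq_refl.
rewrite /winv /= rev_cons -cats1 -/(winv w) /= catA.
apply: (@word_eq_trans _ ([:: (v, b)] ++ ([::] ++ [:: (v, ~~ b)]))).
  rewrite -cat1s; apply: word_eq_cat; first exact: word_eq_refl.
  by apply: word_eq_cat; [exact: IH|exact: word_eq_refl].
exact: word_eq_cancel.
Qed.

Lemma winvK : involutive winv.
Proof.
move=> w; rewrite /winv map_rev revK -map_comp map_id_in // => -[v b] _ /=.
by rewrite negbK.
Qed.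

Lemma word_eq_catNw w : word_eq (winv w ++ w) [::].
Proof. by rewrite -{2}(winvK w); exact: word_eq_catV. Qed.

Lemma word_eq_inv w1 w2 : word_eq w1 w2 -> word_eq (winv w1) (winv w2).
Proof.
move=> h.
apply: (@word_eq_trans _ (winv w1 ++ (w2 ++ winv w2))).
  rewrite -{1}(cats0 (winv w1)); apply: word_eq_cat; first exact: word_eq_refl.
  exact/word_eq_sym/word_eq_catV.
rewrite catA -{2}(cat0s (winv w2)); apply: word_eq_cat; last exact: word_eq_refl.
apply: word_eq_trans (word_eq_catNw w1).
by apply: word_eq_cat; [exact: word_eq_refl|exact: word_eq_sym].
Qed.

Definition raag_mul (x y : raag) : raag := \pi_raag (repr x ++ repr y).
Definition raag_inv (x : raag) : raag := \pi_raag (winv (repr x)).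
Definition raag_one : raag := \pi_raag [::].

Lemma word_eq_repr w : word_eq (repr (\pi_raag w)) w.
Proof. by apply/raag_eqP; rewrite reprK. Qed.

Lemma raag_mulE w1 w2 : raag_mul (\pi_raag w1) (\pi_raag w2) = \pi_raag (w1 ++ w2).
Proof. by apply/raag_eqP; apply: word_eq_cat; exact: word_eq_repr. Qed.

Lemma raag_invE w : raag_inv (\pi_raag w) = \pi_raag (winv w).
Proof. exact/raag_eqP/word_eq_inv/word_eq_repr. Qed.

Fact raag_mulgA : associative raag_mul.
Proof.
move=> x y z; rewrite -[x]reprK -[y]reprK -[z]reprK.
rewrite (raag_mulE (repr y)) (raag_mulE (repr x) (repr y)).
by rewrite (raag_mulE (repr x)) (raag_mulE (_ ++ _)) catA.
Qed.

Fact raag_mul1g : left_id raag_one raag_mul.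
Proof. by move=> x; rewrite -[x]reprK raag_mulE. Qed.

Fact raag_mulg1 : right_id raag_one raag_mul.
Proof. by move=> x; rewrite -[x]reprK raag_mulE cats0. Qed.

Fact raag_mulVg : left_inverse raag_one raag_inv raag_mul.
Proof.
by move=> x; rewrite -[x]reprK raag_invE raag_mulE; exact/raag_eqP/word_eq_catNw.
Qed.

Fact raag_mulgV : right_inverse raag_one raag_inv raag_mul.
Proof.
by move=> x; rewrite -[x]reprK raag_invE raag_mulE; exact/raag_eqP/word_eq_catV.
Qed.

HB.instance Definition _ := isGroup.Build raag
  raag_mulgA raag_mul1g raag_mulg1 raag_mulVg raag_mulgV.

Definition raag_gen (v : V) : raag := \pi_raag [:: (v, true)].

End Raag.

Record sgraph (T : Type) := SGraph {
  vert : set T;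
  adj : T -> T -> Prop;
  adj_sym : forall x y, adj x y -> adj y x;
  adj_irr : forall x, ~ adj x x;
  adj_vert : forall x y, adj x y -> vert x }.

(* Infimum in [0, +oo] of a set of natural numbers: its minimum, or [+oo] when
   the set is empty. *)
Definition nat_inf (R : realType) (A : set nat) : \bar R :=
  ereal_inf [set n%:R%:E%R | n in A].

Section Graphs.
Context (T : choiceType).
Implicit Types G H K : sgraph T.

Definition subgraph H G :=
  vert H `<=` vert G /\ forall x y, adj H x y -> adj G x y.

Fixpoint walk G (n : nat) (x y : T) : Prop :=
  if n is m.+1 then exists2 z, adj G x z & walk G m z y else vert G x /\ x = y.

Definition gdist (R : realType) G (x y : T) : \bar R :=
  nat_inf R [set n | walk G n x y].

Definition weakly_convex (R : realType) G H :=
  subgraph H G /\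
  forall x y, vert H x -> vert H y -> gdist R H x y = gdist R G x y.

Definition locally_finite G :=
  forall x, vert G x -> finite_set [set y | adj G x y].

Definition component G (x : T) : set T := [set y | exists n, walk G n x y].

Definition components G : set (set T) := [set component G x | x in vert G].

Lemma remove_sym G (S : set T) x y :
  [/\ adj G x y, ~ S x & ~ S y] -> [/\ adj G y x, ~ S y & ~ S x].
Proof. by case=> Gxy Sx Sy; split=> //; exact: adj_sym. Qed.

Lemma remove_irr G (S : set T) x : ~ [/\ adj G x x, ~ S x & ~ S x].
Proof. by case=> Gxx _ _; exact: adj_irr Gxx. Qed.

Lemma remove_vert G (S : set T) x y :
  [/\ adj G x y, ~ S x & ~ S y] -> (vert G `\` S) x.
Proof. by case=> Gxy Sx _; split=> //; exact: adj_vert Gxy. Qed.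

Definition remove G (S : set T) : sgraph T :=
  SGraph (@remove_sym G S) (@remove_irr G S) (@remove_vert G S).

(* Ends are equivalence classes of rays: two rays are equivalent when, for every
   finite set [S], they have tails in the same component of [G - S]. *)
Definition ray G (r : nat -> T) :=
  injective r /\ forall n, adj G (r n) (r n.+1).

Definition same_end G (r1 r2 : nat -> T) :=
  forall S, finite_set S -> exists2 C, components (remove G S) C &
    (\forall n \near \oo, C (r1 n)) /\ (\forall n \near \oo, C (r2 n)).

Definition ends G : set (set (nat -> T)) :=
  [set [set r' | ray G r' /\ same_end G r r'] | r in ray G].

Definition end_in (E : set (nat -> T)) (C : set T) :=
  forall r, E r -> \forall n \near \oo, C (r n).

Definition end_separating G (S : set T) :=
  [/\ finite_set S, S `<=` vert G &
   exists E1 E2 : set (nat -> T), [/\ E1 <> E2, ends G = [set E1; E2] &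
     exists C1 C2 : set T,
       [/\ components (remove G S) C1, components (remove G S) C2, C1 <> C2,
           end_in E1 C1 & end_in E2 C2]]].

Definition width (R : realType) G : \bar R :=
  nat_inf R [set n | exists2 S, end_separating G S & (S #= `I_n)%card].

End Graphs.

Section FiniteGraphs.
Context (V : finType) (e : rel V).

(* [ucycle e c] alone also accepts edges traversed back and forth (size 2). *)
Definition embedded_cycle (c : seq V) := (2 < size c)%N /\ ucycle e c.

Definition girth (R : realType) : \bar R :=
  nat_inf R [set size c | c in embedded_cycle].

Definition max_degree : nat := \max_(v : V) #|[pred u | e v u]|.

End FiniteGraphs.

Section ExtensionGraph.
Context (R : realType) (V : finType) (e : rel V).
Local Notation A := (raag e).

Definition ext_vert : set A :=
  [set x | exists v : V, exists g : A, x = raag_gen e v ^ g].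

Definition ext_adj (x y : A) :=
  [/\ ext_vert x, ext_vert y, x <> y & commute x y].

Lemma ext_adj_sym x y : ext_adj x y -> ext_adj y x.
Proof. by case=> xv yv xy cxy; split=> // /esym. Qed.

Lemma ext_adj_irr x : ~ ext_adj x x.
Proof. by case. Qed.

Lemma ext_adj_vert x y : ext_adj x y -> ext_vert x.
Proof. by case. Qed.

Definition ext_graph : sgraph A := SGraph ext_adj_sym ext_adj_irr ext_adj_vert.

(* [tau(g)] computed from the base vertex [x]. *)
Definition translation_length (x g : A) : \bar R :=
  limn (fun n : nat =>
    (gdist R ext_graph x (x ^ (g ^+ n))%g * ((n%:R : R)^-1)%R%:E)%E).

Definition loxodromic (g : A) :=
  exists2 x, vert ext_graph x & (0 < translation_length x g)%E.

Definition cyclic_subgroup (g : A) : set A :=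
  [set h | exists n : nat, h = g ^+ n \/ h = g ^- n].

Definition preserved_by (g : A) (H : sgraph A) :=
  (forall x, vert H (x ^ g) <-> vert H x) /\
  (forall x y, adj H (x ^ g) (y ^ g) <-> adj H x y).

(* The translates of some finite subgraph cover [H]. *)
Definition cocompact (g : A) (H : sgraph A) :=
  exists K : sgraph A, [/\ finite_set (vert K), subgraph K H,
    forall x, vert H x ->
      exists2 h, cyclic_subgroup g h & exists2 u, vert K u & x = u ^ h &
    forall x y, adj H x y ->
      exists2 h, cyclic_subgroup g h &
        exists u v, [/\ adj K u v, x = u ^ h & y = v ^ h]].

Definition axial_subgraph (g : A) (H : sgraph A) :=
  [/\ vert H !=set0, weakly_convex R ext_graph H, locally_finite H,
      preserved_by g H & cocompact g H].

Definition kappa_finiteness (kappa : nat) :=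
  forall g : A, loxodromic g ->
    exists2 H, axial_subgraph g H & (width R H <= kappa%:R%:E)%E%R.

End ExtensionGraph.

(* Main.v *)
Require Import Defs.
From HB Require Import structures.
From mathcomp Require Import all_boot all_order all_algebra.
From mathcomp Require Import all_classical all_reals all_analysis.
From mathcomp Require Import zify.

(* Write r.v for r v r^-1, so that the extension graph is the union of the copies
   r.Gamma of Gamma. Up to conjugation g^-1 is given by a word W of minimal length in
   its conjugacy class, and r_i runs over the prefixes of the bi-infinite periodic word
   ... W W W ..., whose finite segments are all reduced. The axial subgraph is the
   union H of the copies r_i.Gamma.

   An edge path of length k in the extension graph from p.u to q.v amounts to a walk
   u = v_0, ..., v_k = v in Gamma together with a factorization p^-1 q = h_0 ... h_k
   with h_i a word in the star of v_i. Cancelling letters preserves such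
   factorizations, and so does exchanging two adjacent commuting letters a, b, since
   in the absence of cycles of length 3, 4 and 5 a walk between the blocks of a and b
   can be rerouted through the edge {a, b} without becoming longer. As every word can
   be brought to a given reduced form by such moves, a path between vertices of H may
   be replaced by one which is not longer and follows the copies r_i.Gamma.

   A loxodromic element fixes no vertex, so that the letters of W do not lie in a
   single star. Hence every vertex lies in finitely many consecutive copies, and H
   decomposes like a line. Moreover W can be rotated so that its last letter s and its
   first letter t neither coincide nor commute. The copies before and after s meet in
   the star of s, and the vertex s is not in the copies after t; hence removing the
   link of s already separates the two ends. *)

Set Implicit Arguments.
Unset Strict Implicit.
Unset Printing Implicit Defensive.
Import Order.TTheory GRing.Theory Num.Theory numFieldNormedType.Exports.

(** * Normal forms in right-angled Artin groups *)

Section Words.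
Context (V : finType) (e : rel V) (e_sym : symmetric e) (e_irr : irreflexive e).
Implicit Types (a b c : V * bool) (w : word V) (u v : V).

Definition linv a : V * bool := (a.1, ~~ a.2).

Lemma linvK : involutive linv.
Proof. by case=> v b; rewrite /linv /= negbK. Qed.

Inductive shuf : word V -> word V -> Prop :=
| shuf_refl w : shuf w w
| shuf_trans w2 w1 w3 : shuf w1 w2 -> shuf w2 w3 -> shuf w1 w3
| shuf_cons a w w' : shuf w w' -> shuf (a :: w) (a :: w')
| shuf_swap a b w : e a.1 b.1 -> shuf [:: a, b & w] [:: b, a & w].

(** Rewriting that never inserts letters: whatever survives swaps and cancellations, such as the
    support or a factorization along a walk, passes from a word to its reduced forms. *)
Inductive simplifies : word V -> word V -> Prop :=
| simplifies_refl w : simplifies w w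
| simplifies_trans w2 w1 w3 :
    simplifies w1 w2 -> simplifies w2 w3 -> simplifies w1 w3
| simplifies_cons a w w' : simplifies w w' -> simplifies (a :: w) (a :: w')
| simplifies_swap a b w : e a.1 b.1 -> simplifies [:: a, b & w] [:: b, a & w]
| simplifies_cancel a w : simplifies [:: a, linv a & w] w.

Lemma shuf_simplifies w w' : shuf w w' -> simplifies w w'.
Proof.
elim=> {w w'} [w|w2 w1 w3 _ + _|a w w' _|a b w].
- exact: simplifies_refl.
- exact: simplifies_trans.
- exact: simplifies_cons.
- exact: simplifies_swap.
Qed.

Lemma shuf_sym w w' : shuf w w' -> shuf w' w.
Proof.
elim=> {w w'} [w|w2 w1 w3 _ h1 _ h2|a w w' _ h|a b w ab].
- exact: shuf_refl.
- exact: shuf_trans h2 h1.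
- exact: shuf_cons.
- by apply: shuf_swap; rewrite e_sym.
Qed.

Lemma shuf_size w w' : shuf w w' -> size w = size w'.
Proof. by elim=> {w w'} //= [w2 w1 w3 _ -> _ ->|a w w' _ ->]. Qed.

(* [del a w] removes from [w] a letter [a^-1] that can be brought to the front
   by commutations. *)
Fixpoint del a w : option (word V) :=
  if w is b :: w' then
    if b == linv a then Some w'
    else if e b.1 a.1 then omap (cons b) (del a w') else None
  else None.

Definition oshuf (o1 o2 : option (word V)) :=
  match o1, o2 with
  | Some w1, Some w2 => shuf w1 w2 | None, None => True | _, _ => False
  end.

Lemma oshuf_refl o : oshuf o o.
Proof. by case: o => //= w; exact: shuf_refl. Qed.

(** By irreflexivity two letters that may be swapped are never both [linv a], so a swap does not
    affect which letter is removed. *)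
Lemma del_shuf a w w' : shuf w w' -> oshuf (del a w) (del a w').
Proof.
elim=> {w w'} [w|w2 w1 w3 _ + _|b w w' ww' IH|b c w bc].
- exact: oshuf_refl.
- case: (del a w1) (del a w2) (del a w3) => [?|] [?|] [?|] //=.
  exact: shuf_trans.
- rewrite /=; case: eqP => // _; case: ifP => // _.
  by case: (del a w) (del a w') IH => [?|] [?|] //=; exact: shuf_cons.
- rewrite /=; have [ba|bNa] := eqVneq b (linv a).
    rewrite {b}ba in bc *.
    have /negPf-> : c != linv a.
      by apply: contraTneq bc => ->; rewrite /= e_irr.
    by rewrite e_sym bc /=; exact: shuf_refl.
  have [ca|cNa] := eqVneq c (linv a).
    by rewrite ca /= in bc; rewrite bc /=; exact: shuf_refl.
  case: (e b.1 a.1); case: (e c.1 a.1) => //=.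
  by case: (del a w) => //= w'; exact: shuf_swap.
Qed.

Lemma delP a w w' : del a w = Some w' -> shuf w (linv a :: w').
Proof.
elim: w w' => //= b w IH w'; case: eqP => [-> [->]|_]; first exact: shuf_refl.
case: ifP => // ba; case: (del a w) IH => //= w1 /(_ _ erefl) h [<-].
apply: (shuf_trans (shuf_cons b h)); exact: shuf_swap.
Qed.

Lemma del_linv a w : del a (linv a :: w) = Some w.
Proof. by rewrite /= eqxx. Qed.

Lemma del_cons_adj a b w : e b.1 a.1 -> del a (b :: w) = omap (cons b) (del a w).
Proof.
move=> ba /=; rewrite ba; case: eqP => // b_a.
by move: ba; rewrite b_a /= e_irr.
Qed.

Lemma del_front a y z :
  all (fun b => e b.1 a.1) y -> del a (y ++ linv a :: z) = Some (y ++ z).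
Proof.
elim: y => [|b y IH] /=; first by rewrite eqxx.
case/andP=> ba /IH d; have /= -> := del_cons_adj (y ++ linv a :: z) ba.
by rewrite d.
Qed.

Fixpoint reduced w :=
  if w is a :: w' then (del a w' == None) && reduced w' else true.

Lemma reduced_shuf w w' : shuf w w' -> reduced w = reduced w'.
Proof.
elim=> {w w'} // [w2 w1 w3 _ -> _ ->|a w w' ww' IH|a b w ab] //.
- rewrite /= IH; congr (_ && _).
  by have := del_shuf a ww'; case: (del a w) (del a w') => [?|] [?|].
- change ((del a (b :: w) == None) && ((del b w == None) && reduced w) =
          (del b (a :: w) == None) && ((del a w == None) && reduced w)).
  rewrite del_cons_adj 1?e_sym // del_cons_adj //.
  by case: (del a w) (del b w) => [?|] [?|].
Qed.

(** Left multiplication by a letter, as an action on reduced words modulo [shuf]. *)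
Definition push a w := if del a w is Some w' then w' else a :: w.

Lemma push_shuf a w w' : shuf w w' -> shuf (push a w) (push a w').
Proof.
move=> ww'; have := del_shuf a ww'; rewrite /push.
by case: (del a w) (del a w') => [?|] [?|] //= _; exact: shuf_cons.
Qed.

Lemma push_reduced a w : reduced w -> reduced (push a w).
Proof.
rewrite /push; case E: (del a w) => [w'|] /= rw; last by rewrite E.
by move: rw; rewrite (reduced_shuf (delP E)) => /andP[].
Qed.

Lemma push_cancel a w : reduced w -> shuf (push a (push (linv a) w)) w.
Proof.
move=> rw; rewrite /(push (linv a)); case E: (del (linv a) w) => [w'|].
  have ww' := delP E; rewrite linvK in ww'.
  move: rw; rewrite (reduced_shuf ww') /= => /andP[/eqP d _].
  by rewrite /push d; exact: shuf_sym.
by rewrite /push del_linv; exact: shuf_refl.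
Qed.

Lemma push_comm a b w : e a.1 b.1 -> shuf (push a (push b w)) (push b (push a w)).
Proof.
move=> ab; have ba : e b.1 a.1 by rewrite e_sym.
(* Once [linv c] is brought to the front of [w], the deletion for [d] skips it, because the two
   letters commute. *)
have del_Some c d w1 : e c.1 d.1 -> del c w = Some w1 ->
    oshuf (del d w) (omap (cons (linv c)) (del d w1)).
  move=> cd /delP h; rewrite -del_cons_adj //; exact: del_shuf.
rewrite /(push b w) /(push a w).
case Eb: (del b w) => [wb|]; case Ea: (del a w) => [wa|].
- have := del_Some _ _ _ ab Ea; rewrite Eb /push.
  case E1 : (del b wa) => [w1|] //= h1.
  have := del_shuf a h1; rewrite del_linv.
  by case: (del a wb).
- have := del_Some _ _ _ ba Eb; rewrite Ea /push.
  case E1 : (del a wb) => [//|] //= _.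
  by rewrite -/(del b (a :: w)) del_cons_adj // Eb; exact: shuf_refl.
- have := del_Some _ _ _ ab Ea; rewrite Eb /push.
  case E1 : (del b wa) => [//|] //= _.
  by rewrite -/(del a (b :: w)) del_cons_adj // Ea; exact: shuf_refl.
- by rewrite /push !del_cons_adj // Ea Eb /=; exact: shuf_swap.
Qed.

Lemma foldr_push_shuf w w1 w2 :
  shuf w1 w2 -> shuf (foldr push w1 w) (foldr push w2 w).
Proof. by move=> h; elim: w => //= a w IH; exact: push_shuf. Qed.

Lemma foldr_push_reduced w w1 : reduced w1 -> reduced (foldr push w1 w).
Proof. by move=> h; elim: w => //= a w IH; exact: push_reduced. Qed.

(** Van der Waerden's trick: the defining relations hold for the action of letters by [push] on
    reduced words modulo [shuf], so the action depends only on the group element. *)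
Lemma foldr_push_word_eq w1 w2 : word_eq e w1 w2 ->
  forall w, reduced w -> shuf (foldr push w w1) (foldr push w w2).
Proof.
elim=> {w1 w2} [w1|w1 w2 _ IH|w1 w2 w3 _ IH1 _ IH2|w1 w1' w2 w2' _ IH1 _ IH2|v b|u v uv]
  w rw.
- exact: shuf_refl.
- exact/shuf_sym/IH.
- exact: shuf_trans (IH1 _ rw) (IH2 _ rw).
- rewrite !foldr_cat; apply: shuf_trans (foldr_push_shuf _ (IH2 _ rw)).
  exact/IH1/foldr_push_reduced.
- exact: (push_cancel (v, b)).
(* Exchanging the two inner pushes lets [v] meet its inverse, and then [u]. *)
- rewrite /=; apply: (shuf_trans _ (@push_cancel (u, false) w rw)).
  apply/push_shuf/(shuf_trans (push_shuf _ (push_comm _ _))) => //.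
  exact/(@push_cancel (v, false))/push_reduced.
Qed.

Lemma push_simplifies a w : simplifies (a :: w) (push a w).
Proof.
rewrite /push; case E: (del a w) => [w'|]; last exact: simplifies_refl.
apply: (simplifies_trans (simplifies_cons _ (shuf_simplifies (delP E)))).
exact: simplifies_cancel.
Qed.

Lemma foldr_push_simplifies w : simplifies w (foldr push [::] w).
Proof.
elim: w => [|a w IH] /=; first exact: simplifies_refl.
exact: simplifies_trans (simplifies_cons _ IH) (push_simplifies _ _).
Qed.

Lemma foldr_push_id w : reduced w -> foldr push [::] w = w.
Proof. by elim: w => //= a w IH /andP[/eqP d /IH->]; rewrite /push d. Qed.

(** Applied to the empty word, [w1] and [w2] yield shuffles of each other; [w1] simplifies to its
    result, and [w2], being reduced, is its own. *)
Theorem word_eq_simplifies w1 w2 :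
  word_eq e w1 w2 -> reduced w2 -> simplifies w1 w2.
Proof.
move=> w12 r2; apply: (simplifies_trans (foldr_push_simplifies _)).
by apply: shuf_simplifies; have := foldr_push_word_eq w12 (w := [::]) isT;
  rewrite (foldr_push_id r2).
Qed.

Lemma simplifies_size w w' : simplifies w w' -> (size w' <= size w)%N.
Proof.
elim=> {w w'} //= [w2 w1 w3 _ h1 _ h2|a w].
  exact: leq_trans h2 h1.
by apply: leqW.
Qed.

Lemma simplifies_all (P : pred V) w w' : simplifies w w' ->
  all (fun a => P a.1) w -> all (fun a => P a.1) w'.
Proof.
elim=> {w w'} //= [w2 w1 w3 _ + _|a w w' _ IH|a b w _|a w].
- by auto.
- by case/andP => -> /IH.
- by case/and3P => -> -> ->.
- by case/and3P.
Qed.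

Lemma del_split a w w' : del a w = Some w' -> exists y z,
  [/\ w = y ++ linv a :: z, w' = y ++ z & all (fun b => e b.1 a.1) y].
Proof.
elim: w w' => //= b w IH w'; case: eqP => [-> [->]|_]; first by exists [::], w'.
case: ifP => // ba; case: (del a w) IH => //= w1 /(_ _ erefl) [y [z [-> -> ya]]] [<-].
by exists (b :: y), z; rewrite /= ba.
Qed.

Lemma nreducedP w : ~~ reduced w -> exists x a y z,
  w = x ++ a :: y ++ linv a :: z /\ all (fun b => e b.1 a.1) y.
Proof.
elim: w => //= a w IH; rewrite negb_and => /orP[|/IH]; last first.
  by case=> x [b [y [z [-> h]]]]; exists (a :: x), b, y, z.
case E: (del a w) => [w'|] // _.
by have [y [z [-> _ h]]] := del_split E; exists [::], a, y, z.
Qed.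

Lemma simplifies_cat x w w' : simplifies w w' -> simplifies (x ++ w) (x ++ w').
Proof. by move=> h; elim: x => //= a x IH; exact: simplifies_cons. Qed.

Lemma shuf_move a y z : all (fun b => e b.1 a.1) y ->
  shuf (y ++ a :: z) (a :: y ++ z).
Proof.
elim: y => [|b y IH] /=; first by move=> _; exact: shuf_refl.
case/andP=> ba /IH h; apply: (shuf_trans (shuf_cons b h)); exact: shuf_swap.
Qed.

Lemma nreduced_cancel x a y z : all (fun b => e b.1 a.1) y ->
  simplifies (x ++ a :: y ++ linv a :: z) (x ++ y ++ z).
Proof.
move=> ya; apply: simplifies_cat.
have /(@shuf_move (linv a) y z)/shuf_simplifies h : all (fun b => e b.1 (linv a).1) y.
  by [].
exact: (simplifies_trans (simplifies_cons _ h) (simplifies_cancel _ _)).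
Qed.

End Words.

(** * Values of words in the group *)

Section Values.
Local Open Scope group_scope.
Local Open Scope quotient_scope.
Context (V : finType) (e : rel V).
Implicit Types (a b c : V * bool) (w : word V) (u v : V).
Local Notation A := (raag e).

Definition wval w : A := \pi_A w.

Lemma wval_cat w1 w2 : wval (w1 ++ w2) = wval w1 * wval w2.
Proof. by rewrite /wval -raag_mulE. Qed.

Lemma wval_nil : wval [::] = 1.
Proof. by []. Qed.

Lemma wval_cons a w : wval (a :: w) = wval [:: a] * wval w.
Proof. by rewrite -cat1s wval_cat. Qed.

Lemma wval_winv w : wval (winv w) = (wval w)^-1.
Proof. by rewrite /wval -raag_invE. Qed.

Lemma wval_linv a : wval [:: linv a] = (wval [:: a])^-1.
Proof. by rewrite -wval_winv. Qed.

Lemma wval_eqP w1 w2 : wval w1 = wval w2 <-> word_eq e w1 w2.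
Proof. exact: raag_eqP. Qed.

Lemma wval_surj (x : A) : exists w, x = wval w.
Proof. by exists (repr x); rewrite /wval reprK. Qed.

Lemma wval_gen v (s : bool) :
  wval [:: (v, s)] = if s then raag_gen e v else (raag_gen e v)^-1.
Proof. by case: s => //; rewrite -(wval_linv (v, true)). Qed.

Lemma raag_gen_comm u v : e u v -> commute (raag_gen e u) (raag_gen e v).
Proof.
move=> /word_eq_comm/raag_eqP; rewrite -/(wval _) -/(wval [::]).
rewrite (wval_cons _ [:: _; _; _]) (wval_cons _ [:: _; _]) (wval_cons _ [:: _]).
rewrite !wval_gen mulgA -invgM => /mulg1_eq.
by rewrite invgK => /esym.
Qed.

Lemma wval_comm a b : e a.1 b.1 -> commute (wval [:: a]) (wval [:: b]).
Proof.
have VC (x y : A) : commute x y -> commute x^-1 y.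
  by move=> h; apply/commute_sym/commuteV/commute_sym.
case: a b => u [] [v []] /raag_gen_comm; rewrite !wval_gen => h //.
- exact: commuteV.
- exact: VC.
- exact/VC/commuteV.
Qed.

Lemma simplifies_wval w w' : simplifies e w w' -> wval w = wval w'.
Proof.
elim=> {w w'} // [w2 w1 w3 _ -> _ -> //|a w w' _ h|a b w ab|a w].
- by rewrite wval_cons h -wval_cons.
- rewrite (wval_cons a (b :: w)) (wval_cons b w) mulgA (wval_comm ab) -mulgA.
  by rewrite (wval_cons b (a :: w)) (wval_cons a w).
- rewrite (wval_cons a (_ :: w)) (wval_cons (linv a) w) wval_linv; exact: mulVKg.
Qed.

End Values.

(** * Parabolic subgroups, centralizers and edges of the extension graph *)

Section Subgroups.
Local Open Scope group_scope.
Context (V : finType) (e : rel V) (e_sym : symmetric e) (e_irr : irreflexive e).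
Implicit Types (a b c : V * bool) (w : word V) (u v : V) (P : pred V).
Local Notation A := (raag e).
Implicit Types x y r g h : A.
Local Notation wval := (wval e).
Local Notation gen := (raag_gen e).

Lemma reduced_word_eq_size w w' :
  word_eq e w w' -> reduced e w' -> (size w' <= size w)%N.
Proof. by move=> h r; apply/simplifies_size/word_eq_simplifies; eassumption. Qed.

Lemma exists_shorter w : ~~ reduced e w ->
  exists2 w', wval w = wval w' & (size w' < size w)%N.
Proof.
move=> /nreducedP[x [a [y [z [-> ya]]]]]; exists (x ++ y ++ z).
  exact/simplifies_wval/nreduced_cancel.
by rewrite !size_cat /= !size_cat /= !addnS ltnS leqnSn.
Qed.

(** Were [w] not reduced, it would equal a word shorter than the reduced word [w'], which has
    minimal length. *)
Lemma word_eq_shuf w w' : word_eq e w w' -> reduced e w' ->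
  (size w <= size w')%N -> shuf e w w'.
Proof.
move=> ww' r' sw; case: (boolP (reduced e w)) => [rw|/exists_shorter[w1 /wval_eqP h s1]].
  have := foldr_push_word_eq e_sym e_irr ww' (w := [::]) isT.
  by rewrite !foldr_push_id.
have := reduced_word_eq_size (word_eq_trans (word_eq_sym h) ww') r'.
by rewrite leqNgt (leq_trans s1 sw).
Qed.

Definition gen_by P x := exists2 w, x = wval w & all (fun a => P a.1) w.

Lemma gen_by1 P : gen_by P 1.
Proof. by exists [::]. Qed.

Lemma gen_byM P x y : gen_by P x -> gen_by P y -> gen_by P (x * y).
Proof.
by move=> [w -> hw] [w' -> hw']; exists (w ++ w'); rewrite ?wval_cat // all_cat hw.
Qed.

Lemma gen_byV P x : gen_by P x -> gen_by P x^-1.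
Proof.
move=> [w -> hw]; exists (winv w); rewrite ?wval_winv //.
by rewrite all_rev all_map.
Qed.

(** Simplifying a word over [P] to the reduced word [w] introduces no new letters. *)
Lemma gen_by_reduced P w : reduced e w -> gen_by P (wval w) -> all (fun a => P a.1) w.
Proof.
move=> rw [w' /esym/wval_eqP h]; apply: simplifies_all; exact: word_eq_simplifies h rw.
Qed.

Lemma gen_neq1 v : gen v <> 1.
Proof. by move=> /esym/wval_eqP/reduced_word_eq_size/(_ isT). Qed.

Definition star u v := (v == u) || e u v.

Lemma star_comm u a : star u a.1 -> commute (wval [:: a]) (gen u).
Proof.
case/orP => [/eqP ua|ua]; last by apply: (wval_comm (b := (u, true))); rewrite e_sym.
case: a ua => v [] /= ->; rewrite wval_gen; first exact: commute_refl.
exact/commute_sym/commuteV/commute_refl.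
Qed.

Lemma gen_by_star_comm u x : gen_by (star u) x -> commute (gen u) x.
Proof.
move=> [w ->]; elim: w => [_|a w IH /= /andP[ua /IH h]]; first exact: commute1.
rewrite wval_cons; apply: commuteM => //; exact/commute_sym/star_comm.
Qed.

Lemma wval_del a w w' : del e (linv a) w = Some w' -> wval w = wval [:: a] * wval w'.
Proof.
move=> /delP/shuf_simplifies/simplifies_wval ->.
by rewrite linvK wval_cons.
Qed.

Lemma del_cat a w1 w2 : isSome (del e a (w1 ++ w2)) ->
  isSome (del e a w1) \/ all (fun b => e b.1 a.1) w1 /\ isSome (del e a w2).
Proof.
elim: w1 => [|b w IH] /=; first by right.
case: eqP => _; first by left.
case: (e b.1 a.1) => //=.
by case: (del e a (w ++ w2)) (del e a w) IH => [?|] [?|].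
Qed.

(** Front letters in the star of [u] are split off by induction. If there are none, [u w] is
    reduced, hence a shuffle of the equally long [w u]. So some [u] comes to the front of [w u]; it
    is not a letter of [w], hence it is the last one and commutes with all of [w]. Then the first
    letter of [w] would lie in the star, so [w] is empty. *)
Lemma centralizer_gen u x : commute (gen u) x -> gen_by (star u) x.
Proof.
have [w ->] := wval_surj x; have [n] := ubnP (size w); elim: n w => // n IH w.
rewrite ltnS => wn uw.
case: (boolP (reduced e w)) => [rw|/exists_shorter[w' ww' s]]; last first.
  by rewrite ww' in uw *; apply: IH => //; exact: leq_trans wn.
case: (boolP [exists a, star u a.1 && isSome (del e (linv a) w)]).
  move=> /existsP[a /andP[ua]]; case E: (del e (linv a) w) => [w'|] // _.
  have aw : gen_by (star u) (wval [:: a]) by exists [:: a]; rewrite //= ua.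
  have ww' := wval_del E; rewrite ww' in uw *; apply: gen_byM => //.
  apply: IH.
    by have := shuf_size (delP E) => /= sw; rewrite sw in wn.
  rewrite -[wval w'](mulKg (wval [:: a])); apply: commuteM => //.
  exact/commuteV/commute_sym/star_comm.
rewrite negb_exists => /forallP front.
have ru : reduced e ((u, true) :: w).
  rewrite /= rw andbT; case E: (del e (u, true) w) => //.
  by have := front (u, false); rewrite /star eqxx E.
have /word_eq_shuf/(_ ru) : word_eq e (w ++ [:: (u, true)]) ((u, true) :: w).
  by apply/wval_eqP; rewrite wval_cat (wval_cons _ _ w); exact/esym.
rewrite size_cat addn1 => /(_ (leqnn _)) /(del_shuf e_sym e_irr (u, false)).
rewrite (del_linv e (u, false)).
case E: (del _ _ _) => [w'|] // _.
have /del_cat[h|[h _]] : isSome (del e (u, false) (w ++ [:: (u, true)])) by rewrite E.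
  by have := front (u, true); rewrite /star eqxx h.
case: w {wn uw rw ru E w'} front h => [_ _|a w /(_ a)]; first exact: gen_by1.
rewrite /= linvK eqxx andbT /star [e u _]e_sym => /negP h /andP[au _].
by case: h; rewrite au orbT.
Qed.

(** On group elements this is the retraction that kills the generators outside [P]. *)
Definition keep P w : word V := [seq a <- w | P a.1].

Lemma keep_word_eq P w1 w2 : word_eq e w1 w2 -> word_eq e (keep P w1) (keep P w2).
Proof.
elim=> {w1 w2} [w|w1 w2 _|w1 w2 w3 _ h1 _ h2|w1 w1' w2 w2' _ h1 _ h2|v s|u v uv].
- exact: word_eq_refl.
- exact: word_eq_sym.
- exact: word_eq_trans h1 h2.
- by rewrite /keep !filter_cat; exact: word_eq_cat.
- rewrite /keep /=; case: (P v); [exact: word_eq_cancel|exact: word_eq_refl].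
- rewrite /keep /=; case: (P u); case: (P v).
  + exact: word_eq_comm.
  + exact: word_eq_cancel.
  + exact: word_eq_cancel.
  + exact: word_eq_refl.
Qed.

Lemma keep_winv P w : keep P (winv w) = winv (keep P w).
Proof. by rewrite /keep /winv filter_rev filter_map. Qed.

Lemma gen_conj v w : gen v ^ wval w = wval (winv w ++ (v, true) :: w).
Proof. by rewrite wval_cat wval_cons wval_winv. Qed.

(** The retraction onto the subgroup generated by [P] fixes the conjugate and replaces [h] by its
    image. If [v] were outside [P], the conjugate would be sent to 1, although generators are
    nontrivial. *)
Lemma gen_by_conj P v h : gen_by P (gen v ^ h) ->
  P v /\ exists2 k, gen_by P k & gen v ^ h = gen v ^ k.
Proof.
have [w ->] := wval_surj h; rewrite gen_conj => -[w0 ww0 Pw0].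
have /wval_eqP/(keep_word_eq P)/wval_eqP := ww0.
rewrite /keep filter_cat -/(keep P _) keep_winv /= -/(keep P w) (all_filterP Pw0) -ww0.
case: ifP => Pv h0.
  split=> //; exists (wval (keep P w)); last by rewrite gen_conj h0.
  by exists (keep P w) => //; exact: filter_all.
case: (gen_neq1 (v := v)); apply: (conjg_inj (wval w)).
by rewrite gen_conj -h0 wval_cat wval_winv mulVg conj1g.
Qed.

(** The vertex r.v = r v r^-1 of the copy r.Gamma; inverting the exponent makes left multiplication
    of [r] permute the copies. *)
Definition vtx r v : A := gen v ^ r^-1.

Lemma vtx_mul g r v : vtx (g * r) v = vtx r v ^ g^-1.
Proof. by rewrite /vtx invgM conjgM. Qed.

(** A conjugate of [u] lying in the subgroup generated by [v] alone forces the two vertices to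
    agree. *)
Lemma vtx_label r u r' v : vtx r u = vtx r' v -> u = v.
Proof.
move=> /(congr1 (conjg^~ r')); rewrite /vtx conjgKV -conjgM => h.
have /gen_by_conj[/eqP->//] : gen_by (pred1 v) (gen u ^ (r^-1 * r')).
by rewrite h; exists [:: (v, true)]; rewrite //= eqxx.
Qed.

Lemma vtx_eqP r r' u : vtx r u = vtx r' u <-> gen_by (star u) (r^-1 * r').
Proof.
split=> [/(congr1 (conjg^~ r'))|/gen_by_star_comm/commgP/conjg_fixP h].
  rewrite /vtx conjgKV -conjgM => /conjg_fixP/commgP; exact: centralizer_gen.
by apply: (conjg_inj r'); rewrite /vtx conjgKV -conjgM.
Qed.

Lemma ext_vertP x : ext_vert x <-> exists r v, x = vtx r v.
Proof.
split=> [[v [g ->]]|[r [v ->]]]; last by exists v, r^-1.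
by exists g^-1, v; rewrite /vtx invgK.
Qed.

(** Two commuting vertices lie in one copy: translated by [r], the second lies in the centralizer of
    [u], so its conjugator may be chosen as some [k] generated by the star of [u]. As [k] fixes [u],
    the copy of r k^-1 contains both. *)
Lemma ext_adjP x y :
  ext_adj x y <-> exists r u v, [/\ e u v, x = vtx r u & y = vtx r v].
Proof.
split=> [[/ext_vertP[r [u ->]] /ext_vertP[r' [v ->]] xy]|[r [u [v [uv -> ->]]]]]; last first.
  split; try by apply/ext_vertP; do 2 eexists.
    by move=> /vtx_label uE; move: uv; rewrite uE e_irr.
  have := raag_gen_comm uv; rewrite /commute /vtx => h.
  by rewrite -!conjMg h.
move=> cxy; have : commute (gen u) (gen v ^ (r'^-1 * r)).
  have := congr1 (conjg^~ r) cxy; rewrite (conjMg (vtx r u)) (conjMg (vtx r' v)).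
  rewrite /vtx conjgKV -conjgM.
  by [].
move=> cuv; have /gen_by_conj[uv [k ku vk]] := centralizer_gen cuv.
have rk : vtx r u = vtx (r * k^-1) u.
  by apply/vtx_eqP; rewrite mulgA mulVg mul1g; exact: gen_byV.
have vrk : vtx r' v = vtx (r * k^-1) v.
  by rewrite /vtx invgM invgK conjgM -vk conjgM conjgK.
exists (r * k^-1), u, v; split=> //.
case/orP: uv => // /eqP uv; case: xy; rewrite rk vrk uv //.
Qed.

End Subgroups.

(** * Factorizations along walks *)

Section Factorizations.
Context (V : finType) (e : rel V) (e_sym : symmetric e) (e_irr : irreflexive e).
Implicit Types (a b c : V * bool) (w : word V) (u v z : V) (k : nat).
Local Notation star := (star e).

(* [factors w u v k]: there is a walk [u = v_0, ..., v_l = v] in the graph with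
   [l <= k] along which [w] factors as a product of blocks [h_0 ... h_l], the
   letters of [h_i] being in the star of [v_i]. *)
Inductive factors : word V -> V -> V -> nat -> Prop :=
| factors_nil u k : factors [::] u u k
| factors_letter a w u v k : star u a.1 -> factors w u v k -> factors (a :: w) u v k
| factors_step w u u' v k : e u u' -> factors w u' v k -> factors w u v k.+1.

Lemma factors_leq w u v k k' : factors w u v k -> (k <= k')%N -> factors w u v k'.
Proof.
move=> h; elim: h k' => {w u v k} [u k|a w u v k ua _ IH|w u u' v k uu' _ IH] k' kk'.
- exact: factors_nil.
- exact: factors_letter ua (IH _ kk').
- by case: k' kk' => // k' kk'; exact: factors_step uu' (IH _ kk').
Qed.

Lemma factors_cat w1 w2 u z v j k :
  factors w1 u z j -> factors w2 z v k -> factors (w1 ++ w2) u v (j + k).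
Proof.
move=> h; elim: h v w2 k => {w1 u z j} [u j|a w u v j ua _ IH|w u u' v j uu' _ IH] v' w2 k h2.
- exact: factors_leq h2 (leq_addl _ _).
- exact: factors_letter ua (IH _ _ _ h2).
- by rewrite addSn; exact: factors_step uu' (IH _ _ _ h2).
Qed.

Lemma factors_cons a w u v k : factors (a :: w) u v k -> exists z j i,
  [/\ factors [::] u z j, star z a.1, factors w z v i & (j + i = k)%N].
Proof.
move=> h; move E : (a :: w) h => w' h.
elim: h E => {w' u v k} // [b w' u v k ub h _ [-> ->]|w' u u' v k uu' _ IH /IH].
  by exists u, 0, k; split=> //; exact: factors_nil.
case=> z [j [i [h1 za h2 <-]]]; exists z, j.+1, i; split=> //.
exact: factors_step uu' h1.
Qed.

Lemma factors_nil_inv u z j : factors [::] u z j ->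
  u = z \/ exists2 u', e u u' & exists2 i, j = i.+1 & factors [::] u' z i.
Proof.
move=> h; move E : [::] h => w' h.
case: h E => {w' u z j} // [|w' u u' v k uu' h w'0]; first by left.
by right; exists u' => //; exists k => //; rewrite w'0.
Qed.

Context (no_short_cycle : forall c : seq V, (2 < size c)%N -> (size c < 6)%N -> ~ ucycle e c).

Lemma factors_swap a b w u v k :
  e a.1 b.1 -> factors [:: a, b & w] u v k -> factors [:: b, a & w] u v k.
Proof.
move=> ab /factors_cons[u1 [j1 [i1 [h1 u1a + <-]]]].
move=> /factors_cons[z [j2 [i2 [h2 zb h <-]]]].
rewrite -[_ :: _]/([::] ++ [:: b, a & w]).
(* [u1] carries the block of [a] and [z] that of [b]; if one of the two blocks admits both letters,
   they are exchanged inside it. *)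
have done1 : star u1 b.1 -> factors [:: b, a & w] u1 v (j2 + i2).
  by move=> u1b; do 2 apply: factors_letter => //; exact: factors_cat h2 h.
have done2 : star z a.1 -> factors [:: b, a & w] u1 v (j2 + i2).
  by move=> za; apply: (factors_cat h2); do 2 apply: factors_letter => //.
apply: (factors_cat h1).
have [/done1//|u1Nb] := boolP (star u1 b.1).
have [/done2//|zNa] := boolP (star z a.1).
move: u1Nb zNa; rewrite /star !negb_or => /andP[bu1 u1b] /andP[az za].
have u1_a : e u1 a.1.
  case/orP: u1a => // /eqP au1; by rewrite -au1 ab in u1b.
have z_b : e z b.1.
  case/orP: zb => // /eqP bz; by rewrite -bz e_sym ab in za.
have au1 : a.1 != u1 by apply: contraTneq u1_a => ->; rewrite e_irr.
have bz : b.1 != z by apply: contraTneq z_b => ->; rewrite e_irr.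
have aNb : a.1 != b.1 by apply: contraTneq ab => ->; rewrite e_irr.
have u1z : u1 != z by apply: contraNneq za => <-.
(* A walk of length at least 3 from [u1] to [z] is replaced by the path through [a.1] and [b.1],
   both letters being read at [a.1]. *)
have [j3|] := leqP 3 j2.
  apply: (@factors_leq _ _ _ (3 + i2)); last by rewrite leq_add2r.
  apply: (factors_step u1_a); apply: factors_letter; first by rewrite /star ab orbT.
  apply: factors_letter; first by rewrite /star eqxx.
  apply: (factors_step ab); apply: factors_step h; by rewrite e_sym.
(* A shorter walk has length 1 or 2, and closes up with this path to a cycle of length 4 or 5. *)
case/factors_nil_inv: h2 => [|[m u1m [i ->]]].
  by move/eqP; rewrite (negPf u1z).
case/factors_nil_inv=> [mz _|[m' mm' [i' ->]]].
- case: (@no_short_cycle [:: u1; a.1; b.1; z]) => //.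
  rewrite mz in u1m; rewrite /ucycle /= u1_a ab e_sym z_b e_sym u1m !inE !negb_or.
  by rewrite eq_sym au1 eq_sym bu1 u1z aNb az bz.
case/factors_nil_inv=> [m'z _|[? _ [? ->]] //].
- case: (@no_short_cycle [:: u1; a.1; b.1; z; m]) => //.
  rewrite m'z in mm'.
  have u1Nm : u1 != m by apply: contraTneq u1m => ->; rewrite e_irr.
  have zNm : z != m by apply: contraTneq mm' => ->; rewrite e_irr.
  have aNm : a.1 != m by apply: contraNneq za => ->; rewrite e_sym.
  have bNm : b.1 != m by apply: contraNneq u1b => ->.
  rewrite /ucycle /= u1_a ab e_sym z_b e_sym mm' e_sym u1m !inE !negb_or.
  by rewrite eq_sym au1 eq_sym bu1 u1z u1Nm aNb az aNm bz bNm zNm.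
Qed.

Lemma factors_simplifies w w' u v k :
  simplifies e w w' -> factors w u v k -> factors w' u v k.
Proof.
move=> h; elim: h u v k => {w w'} [w|w2 w1 w3 _ IH1 _ IH2|a w w' _ IH|a b w ab|a w] u v k h.
- by [].
- exact/IH2/IH1.
- case/factors_cons: h => z [j [i [h1 za /IH h2 <-]]].
  exact: (factors_cat h1 (factors_letter za h2)).
- exact: factors_swap.
- case/factors_cons: h => z [j [i [h1 _ /factors_cons[z' [j' [i' [h2 _ h <-]]]] <-]]].
  exact: (factors_cat h1 (factors_cat h2 h)).
Qed.

End Factorizations.

Lemma girth_no_short_cycle (R : realType) (V : finType) (e : rel V) :
  (6%:R%:E <= girth e R)%E%R ->
  forall c, (2 < size c)%N -> (size c < 6)%N -> ~ ucycle e c.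
Proof.
move=> g6 c c2 c6 cc.
have : (girth e R <= (size c)%:R%:E)%E%R.
  by apply: ereal_inf_lbound; exists (size c) => //; exists c.
move=> /(le_trans g6); rewrite lee_fin ler_nat leqNgt c6 //.
Qed.

(** * Walks and rays *)

Section Walks.
Local Open Scope classical_set_scope.
Context (T : choiceType).
Implicit Types (G H : sgraph T) (S : set T) (x y z : T) (r : nat -> T).

Lemma adj_vertr G x y : adj G x y -> vert G y.
Proof. by move=> xy; exact: adj_vert (adj_sym xy). Qed.

Lemma walk_vertl G n x y : walk G n x y -> vert G x.
Proof. by case: n => [|n] /= [] // z xz _; exact: adj_vert xz. Qed.

Lemma walk_cat G m n x y z : walk G m x y -> walk G n y z -> walk G (m + n) x z.
Proof.
elim: m x => [|m IH] x /=; first by case=> _ ->.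
by case=> t xt ty yz; exists t => //; exact: IH yz.
Qed.

Lemma walk1 G x y : adj G x y -> walk G 1 x y.
Proof. by move=> xy; exists y => //; split=> //; exact: adj_vertr xy. Qed.

Lemma walk_sym G n x y : walk G n x y -> walk G n y x.
Proof.
elim: n x => [|n IH] x /=; first by case=> ? <-.
by case=> z xz /IH zy; have := walk_cat zy (walk1 (adj_sym xz)); rewrite addn1.
Qed.

Lemma walk_closed G (P : set T) n x y :
  (forall a b, adj G a b -> P a -> P b) -> walk G n x y -> P x -> P y.
Proof.
move=> GP; elim: n x => [|n IH] x /=; first by case=> _ ->.
by case=> z xz zy Px; apply: IH zy _; exact: GP xz Px.
Qed.

Lemma component_refl G x : vert G x -> component G x x.
Proof. by move=> Gx; exists 0. Qed.

Lemma component_sym G x y : component G x y -> component G y x.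
Proof. by case=> n /walk_sym; exists n. Qed.

Lemma component_trans G y x z :
  component G x y -> component G y z -> component G x z.
Proof. by case=> m h [n h']; exists (m + n)%N; exact: walk_cat h h'. Qed.

Lemma component_vert G x y : component G x y -> vert G y.
Proof. by move=> /component_sym[n /walk_vertl]. Qed.

Lemma ray_avoid G r S : ray G r -> finite_set S -> \forall n \near \oo, ~ S (r n).
Proof.
case=> r_inj _ /finite_seqP[s ->]; elim: s => [|y s IH]; first by exists 0%N.
have : \forall n \near \oo, r n <> y.
  have [[m <-]|h] := pselect (exists m, r m = y).
    by exists m.+1 => // n /= mn /r_inj nm; rewrite nm ltnn in mn.
  by exists 0%N => // n _ ny; apply: h; exists n.
apply: filterS2 IH => n; rewrite /= inE => ns ny.
by apply/negP; rewrite negb_or; apply/andP; split; [exact/eqP|exact/negP].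
Qed.

(* The ray is obtained by erasing the loops of [f] : from a vertex, jump to the
   last visit of [f] to it and take one more step. *)
Lemma ray_of_walk G (f : nat -> T) : (forall n, adj G (f n) (f n.+1)) ->
    (forall y, \forall n \near \oo, f n <> y) ->
  exists r (t : nat -> nat), ray G r /\ forall n, (n <= t n)%N /\ r n = f (t n).
Proof.
move=> f_adj f_leave.
have last_visit y : exists l, (forall n, f n = y -> (n <= l)%N) /\
                               ((exists n, f n = y) -> f l = y).
  have [N _ hN] := f_leave y.
  have leN n : f n == y -> (n <= N)%N.
    by move=> /eqP fn; rewrite leqNgt; apply/negP => /ltnW nN; exact: hN nN fn.
  have [[n0 /eqP fn0]|h] := pselect (exists n, f n = y).
    have ex : exists n, f n == y by exists n0.
    case: (ex_maxnP ex leN) => l /eqP fl max_l; exists l; split=> // n /eqP.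
    exact: max_l.
  by exists 0%N; split=> // n fn; case: h; exists n.
have /choice[l hl] := last_visit.
pose t := fix t n := if n is m.+1 then (l (f (t m))).+1 else 0%N.
have t_lt n : (t n < t n.+1)%N by rewrite /= ltnS; apply: (hl _).1.
have t_mono m n : (m < n)%N -> (t m < t n)%N.
  elim: n => // n IH; rewrite ltnS leq_eqVlt => /orP[/eqP->//|/IH h].
  exact: ltn_trans h (t_lt n).
have t_new m n : (m < n)%N -> f (t m) <> f (t n).
  move=> mn fmn; have := (hl (f (t m))).1 _ (esym fmn).
  rewrite leqNgt => /negP[]; rewrite -ltnS.
  have : (t m.+1 <= t n)%N by case: (ltngtP m.+1 n) mn => [/t_mono/ltnW||->].
  by rewrite /= => h; rewrite ltnS.
exists (f \o t), t; split; last first.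
  by elim=> [|n [IH _]]; split=> //; exact: leq_ltn_trans IH (t_lt n).
split=> [m n /= fmn|n /=].
  by case: (ltngtP m n) => // /t_new; rewrite fmn.
rewrite -{1}((hl (f (t n))).2) //; by exists (t n).
Qed.

End Walks.

(** * Graphs decomposed along the integers *)

Section PathDecompositions.
Local Open Scope classical_set_scope.
Local Open Scope ring_scope.
Context (T : choiceType).
Implicit Types (G H : sgraph T) (C : int -> set T) (S : set T) (x y z : T).
Implicit Types (r : nat -> T) (i j k N : int).

(** Finite bags [C i] arranged along a line, each vertex occupying a bounded interval of them.
    Connectedness of a bag is stated after the removal of any [S] missing it, which is the form
    needed to compare ends. *)
Record path_decomposition G C : Prop := PathDecomposition {
  pd_vert : forall x, vert G x <-> exists i, C i x;
  pd_adj : forall x y, adj G x y -> exists2 i, C i x & C i y;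
  pd_fin : forall i, finite_set (C i);
  pd_conv : forall i j k x, i <= j -> j <= k -> C i x -> C k x -> C j x;
  pd_bnd : forall x, exists N, forall i, C i x -> `|i| <= N;
  pd_conn : forall i S x y, (forall z, C i z -> ~ S z) -> C i x -> C i y ->
    component (remove G S) x y;
  pd_next : forall i, C i `&` C (i + 1) !=set0 }.

Definition upper C N : set T := [set x | exists2 i, N <= i & C i x].
Definition goes_up C r := forall N, \forall n \near \oo, upper C N (r n).

(** Reversing the line transfers every statement about the positive end to the negative one. *)
Lemma pd_opp G C : path_decomposition G C -> path_decomposition G (C \o -%R).
Proof.
case=> h1 h2 h3 h4 h5 h6 h7; split=> /= [x|x y /h2[i Cx Cy]|i|i j k x ij jk Ci Ck|x|i|i].
- by rewrite h1; split=> -[i Ci]; exists (- i); rewrite ?opprK.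
- by exists (- i); rewrite opprK.
- exact: h3.
- by apply: h4 Ck Ci; lia.
- by have [N hN] := h5 x; exists N => i /hN; rewrite normrN.
- exact: h6.
- have [x []] := h7 (- i - 1); rewrite subrK => Cx Cx'; exists x; split=> //.
  by rewrite opprD.
Qed.

Section Theory.
Context G C (pd : path_decomposition G C).

Lemma finite_bnd S : finite_set S ->
  exists N, forall x i, S x -> C i x -> `|i| <= N.
Proof.
move=> /finite_seqP[s ->]; elim: s => [|y s [N hN]]; first by exists 0.
have [M hM] := pd_bnd pd y; exists (Num.max M N) => x i; rewrite /= inE le_max.
by move=> /orP[/eqP-> /hM->//|xs /(hN _ _ xs)->]; rewrite orbT.
Qed.

Lemma upper_component S N x y :
    (forall z, upper C N z -> ~ S z) -> upper C N x -> upper C N y ->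
  component (remove G S) x y.
Proof.
move=> NS [i Ni Cx] [j Nj Cy]; wlog ij : i j x y Ni Cx Nj Cy / i <= j.
  by move=> h; case/orP: (le_total i j) => ij; last apply: component_sym; apply: h ij.
have [n jE] : exists n : nat, j = i + n%:Z by exists `|j - i|%N; lia.
elim: n i x {ij} Ni Cx jE => [|n IH] i x Ni Cx jE.
  rewrite addr0 in jE; rewrite jE in Cy; apply: pd_conn Cx Cy => // z Cz.
  by apply: NS; exists i.
have [z [Cz Cz']] := pd_next pd i; apply: (component_trans (y := z)).
  by apply: pd_conn Cx Cz => // t Ct; apply: NS; exists i.
apply: (IH (i + 1)) => //; [by rewrite ler_wpDr|by lia].
Qed.

(** All bags far enough up miss the finite set [S], and their union stays connected. *)
Lemma ups_same_end r1 r2 : goes_up C r1 -> goes_up C r2 ->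
  forall S, finite_set S -> exists2 x, vert (remove G S) x &
    (\forall n \near \oo, component (remove G S) x (r1 n)) /\
    (\forall n \near \oo, component (remove G S) x (r2 n)).
Proof.
move=> up1 up2 S fS; have [N hN] := finite_bnd fS.
have NS z : upper C (N + 1) z -> ~ S z.
  by case=> i Ni Ci Sz; have := hN _ _ Sz Ci; lia.
have [x [Cx _]] := pd_next pd (N + 1).
have ux : upper C (N + 1) x by exists (N + 1).
exists x; first by split; [apply/(pd_vert pd); exists (N + 1)|exact: NS].
split.
- have := up1 (N + 1); apply: filterS => n; exact: upper_component.
- have := up2 (N + 1); apply: filterS => n; exact: upper_component.
Qed.

(** The intersection of two consecutive bags separates: if the bag of the edge had index at most
    [i], convexity would put [x] in both bags. *)
Lemma adj_cut i x y : adj G x y -> ~ (C i `&` C (i + 1)) x -> ~ (C i `&` C (i + 1)) y ->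
  upper C (i + 1) x -> upper C (i + 1) y.
Proof.
move=> /(pd_adj pd)[j Cjx Cjy] xN yN [k ik Ckx].
have [ij|ji] := ltrP i j; first by exists j => //; lia.
case: xN; split; apply: (pd_conv pd _ _ Cjx Ckx); lia.
Qed.

(** Once the ray has left the finite separator it can no longer change sides. *)
Lemma ray_up_or_not i r : ray G r ->
  (\forall n \near \oo, upper C (i + 1) (r n)) \/
  (\forall n \near \oo, ~ upper C (i + 1) (r n)).
Proof.
move=> rr; have f : finite_set (C i `&` C (i + 1)) by exact/finite_setIl/(pd_fin pd).
have [n0 _ hn0] := ray_avoid rr f.
have step n : (n0 <= n)%N -> upper C (i + 1) (r n) <-> upper C (i + 1) (r n.+1).
  move=> n0n; have a := rr.2 n; have h := hn0 n n0n.
  have h' := hn0 n.+1 (leqW n0n).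
  by split; apply: adj_cut => //; exact: adj_sym.
have all n : (n0 <= n)%N -> upper C (i + 1) (r n0) <-> upper C (i + 1) (r n).
  elim: n => [|n IH]; first by rewrite leqn0 => /eqP->.
  rewrite leq_eqVlt => /orP[/eqP->//|]; rewrite ltnS => n0n.
  by rewrite (IH n0n); exact: step.
have [u|u] := pselect (upper C (i + 1) (r n0)); [left|right].
  by exists n0 => // n /= /all <-.
by exists n0 => // n /= /all <-.
Qed.

Lemma ray_goes_up r : ray G r -> (\forall n \near \oo, upper C 1 (r n)) -> goes_up C r.
Proof.
move=> rr up1 N.
(* The ray finally leaves the finitely many bags of index between 1 and [N]. *)
pose F := \bigcup_(k in `I_(`|N|%N)) C k%:Z.
have fF : finite_set F by apply: bigcup_finite => // k _; exact: pd_fin pd _.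
apply: filterS2 up1 (ray_avoid rr fF) => n [i i1 Ci] nF.
exists i => //; rewrite leNgt; apply/negP => iN; apply: nF.
exists `|i|%N; first by rewrite /=; lia.
by have -> : `|i|%N%:Z = i by lia.
Qed.

End Theory.

End PathDecompositions.

(** * The two ends of a decomposed graph *)

Section EndsOfPathDecompositions.
Local Open Scope classical_set_scope.
Local Open Scope ring_scope.
Context (T : choiceType).
Implicit Types (G H : sgraph T) (C : int -> set T) (S : set T) (x y z : T).
Implicit Types (r : nat -> T) (i j k N : int).

Definition up_rays G C := [set r | ray G r /\ goes_up C r].

(** A ray that finally avoids both the bags from 1 upwards and those from -1 downwards would be
    confined to the finite bag [C 0]. *)
Lemma ray_up_or_down G C (pd : path_decomposition G C) r :
  ray G r -> goes_up C r \/ goes_up (C \o -%R) r.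
Proof.
move=> rr; have pd' := pd_opp pd.
have [u|u] := ray_up_or_not pd 0 rr; first by left; apply: (ray_goes_up pd rr).
have [d|d] := ray_up_or_not pd' 0 rr; first by right; apply: (ray_goes_up pd' rr).
have [n []] := filter_ex (filterI (filterI u d) (ray_avoid rr (pd_fin pd 0))).
move=> [un dn] n0; have /(pd_vert pd)[i Ci] := adj_vert (rr.2 n).
have [i1|] := leP 1 i; first by case: un; exists i.
have [i1 _|i1 i1'] := leP i (- 1); first by case: dn; exists (- i); rewrite /= ?opprK //; lia.
by case: n0; have -> : 0 = i by lia.
Qed.

(** The separator between the bags 0 and 1 tells the rays apart: a walk avoiding it from the first
    ray ends in the upper part, while the second ray is also in a bag of index at most 0. *)
Lemma up_down_separated G C (pd : path_decomposition G C) r1 r2 :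
  goes_up C r1 -> goes_up (C \o -%R) r2 -> ~ same_end G r1 r2.
Proof.
move=> up down /(_ (C 0 `&` C (0 + 1)))[|_ [x Sx <-]].
  exact/finite_setIl/(pd_fin pd).
case=> x1 x2; have [n [[xn1 xn2] [u d]]] :=
  filter_ex (filterI (filterI x1 x2) (filterI (up (0 + 1)) (down 0))).
have [k kwalk] := component_trans (component_sym xn1) xn2.
have [_ r2S] := component_vert xn2.
have [i i1 Ci] : upper C (0 + 1) (r2 n).
  by apply: walk_closed kwalk u => a b [ab Sa Sb]; exact: (adj_cut pd).
have [j j0 Cj] := d; apply: r2S; split; apply: (pd_conv pd _ _ Cj Ci); lia.
Qed.

Lemma end_of_up_ray G C (pd : path_decomposition G C) r :
  ray G r -> goes_up C r -> [set r' | ray G r' /\ same_end G r r'] = up_rays G C.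
Proof.
move=> rr ru; apply/seteqP; split=> r' [rr' h]; split=> //.
  have [//|d] := ray_up_or_down pd rr'.
  by case: (up_down_separated pd ru d).
move=> S fS; have [x xS hx] := ups_same_end pd ru h fS.
by exists (component (remove G S) x) => //; exists x.
Qed.

Lemma ends_path_decomposition G C (pd : path_decomposition G C) r1 r2 :
    ray G r1 -> goes_up C r1 -> ray G r2 -> goes_up (C \o -%R) r2 ->
  ends G = [set up_rays G C; up_rays G (C \o -%R)].
Proof.
move=> rr1 u1 rr2 u2; have pd' := pd_opp pd.
apply/seteqP; split=> [_ [r rr <-]|_ [] ->].
- have [u|d] := ray_up_or_down pd rr; [left|right].
    exact: (end_of_up_ray pd).
  exact: (end_of_up_ray pd').
- by exists r1 => //; exact: (end_of_up_ray pd).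
- by exists r2 => //; exact: (end_of_up_ray pd').
Qed.

Lemma up_rays_in G C (pd : path_decomposition G C) S x r :
    finite_set S -> goes_up C r ->
    (\forall n \near \oo, component (remove G S) x (r n)) ->
  end_in (up_rays G C) (component (remove G S) x).
Proof.
move=> fS u xr r' [_ u']; have [y _ [yr yr']] := ups_same_end pd u u' fS.
have [n [xn yn]] := filter_ex (filterI xr yr).
apply: filterS yr' => m; apply: component_trans.
exact: component_trans xn (component_sym yn).
Qed.

(** [L] is the lower side, invariant under walks avoiding [S]. If both ends were in one component, a
    walk would carry [L] to vertices high up. *)
Lemma end_separating_cut G C (pd : path_decomposition G C) r1 r2 S (L : set T) N M :
    ray G r1 -> goes_up C r1 -> ray G r2 -> goes_up (C \o -%R) r2 ->
    finite_set S -> S `<=` vert G ->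
    (forall x y, adj (remove G S) x y -> L x -> L y) ->
    (forall x, upper C N x -> ~ L x) ->
    (forall x, upper (C \o -%R) M x -> ~ S x -> L x) ->
  end_separating G S.
Proof.
move=> rr1 u1 rr2 u2 fS SG SL NL ML; have pd' := pd_opp pd.
split=> //; exists (up_rays G C), (up_rays G (C \o -%R)).
have [x1 Sx1 [h1 _]] := ups_same_end pd u1 u1 fS.
have [x2 Sx2 [h2 _]] := ups_same_end pd' u2 u2 fS.
split.
- move=> E; have [_ d1] : up_rays G (C \o -%R) r1 by rewrite -E.
  apply: (up_down_separated pd u1 d1) => F fF.
  have [x Fx h] := ups_same_end pd u1 u1 fF.
  by exists (component (remove G F) x) => //; exists x.
- exact: (ends_path_decomposition pd rr1 u1 rr2 u2).
exists (component (remove G S) x1), (component (remove G S) x2).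
split; [by exists x1|by exists x2| |exact: (up_rays_in pd fS u1)|exact: (up_rays_in pd' fS u2)].
move=> E; rewrite E in h1.
have [n [[xn1 xn2] [u d]]] := filter_ex (filterI (filterI h1 h2) (filterI (u1 N) (u2 M))).
have [k kwalk] := component_trans (component_sym xn2) xn1.
apply: NL u _; apply: walk_closed kwalk _ => //.
by apply: ML => //; have [] := component_vert xn2.
Qed.

Lemma goes_up_ray G C (pd : path_decomposition G C) (f : nat -> T) :
    (forall n, adj G (f n) (f n.+1)) -> goes_up C f ->
  exists2 r, ray G r & goes_up C r.
Proof.
move=> f_adj f_up; have [|r [t [rr rt]]] := ray_of_walk f_adj.
  move=> y; have [N hN] := pd_bnd pd y.
  have := f_up (N + 1); apply: filterS => n [i Ni Ci] fn.
  by rewrite fn in Ci; have := hN _ Ci; lia.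
exists r => // N; have [n0 _ h] := f_up N; exists n0 => // n /= n0n.
by rewrite (rt n).2; apply: h => /=; exact: leq_trans n0n (rt n).1.
Qed.

Lemma walk_vertices G (n : nat) x y : walk G n x y -> exists z : nat -> T,
  [/\ z 0%N = x, z n = y & forall i : nat, (i < n)%N -> adj G (z i) (z i.+1)].
Proof.
elim: n x => [|n IH] x /=; first by case=> _ <-; exists (fun=> x).
case=> t xt /IH[z [z0 zn za]]; exists (fun i => if i is j.+1 then z j else x).
by split=> // -[|i] //= ; [rewrite z0|exact: za].
Qed.

(** The translates under powers of [phi] of a walk from [x] to its image are concatenated; each
    period climbs by [m], and erasing loops leaves a ray. *)
Lemma periodic_up_ray G C (pd : path_decomposition G C) (phi : T -> T) (m : int) x :
    0 < m -> (forall a b, adj G a b -> adj G (phi a) (phi b)) ->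
    (forall i a, C i a -> C (i + m) (phi a)) -> component G x (phi x) ->
  exists2 r, ray G r & goes_up C r.
Proof.
move=> m0 phi_adj phiC [k xk].
have iter_adj n a b : adj G a b -> adj G (iter n phi a) (iter n phi b).
  by move=> ab; elim: n => //= n; exact: phi_adj.
have iterC n i a : C i a -> C (i + m * n%:Z) (iter n phi a).
  move=> Ca; elim: n => [|n /= /phiC]; first by rewrite mulr0 addr0.
  by have -> : i + m * n.+1%:Z = i + m * n%:Z + m by lia.
have [z [z0 zk zadj]] := walk_vertices xk.
(* A walk of length 0 would make [x] a fixed point of [phi], and [x] would lie in bags arbitrarily
   far up. *)
have k0 : (0 < k)%N.
  rewrite lt0n; apply/eqP => k0.
  have fx : phi x = x by rewrite -zk k0.
  have /(pd_vert pd)[i Ci] := walk_vertl xk.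
  have [N /(_ (i + m * (`|N| + `|i| + 1)%N%:Z))] := pd_bnd pd x.
  by rewrite -{1}(iter_fix (`|N| + `|i| + 1) fx) => /(_ (iterC _ _ _ Ci)); nia.
pose f n := iter (n %/ k)%N phi (z (n %% k)%N).
have f_succ n : f n.+1 = iter (n %/ k)%N phi (z (n %% k).+1%N).
  rewrite /f {1 2}(divn_eq n k) -addnS.
  have [sk|] := ltnP (n %% k).+1%N k.
    by rewrite divnMDl // modnMDl (divn_small sk) (modn_small sk) addn0.
  (* At the end of a period, [z k] is the image of [z 0], the start of the next translate. *)
  rewrite leq_eqVlt ltnS leqNgt ltn_pmod // orbF => /eqP <-.
  by rewrite -mulSnr mulnK // modnMl z0 iterSr -zk.
have f_adj n : adj G (f n) (f n.+1).
  by rewrite f_succ; apply/iter_adj/zadj; rewrite ltn_pmod.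
apply: (goes_up_ray pd f_adj) => N.
have [B hB] : exists B, forall i a, (z @` `I_k) a -> C i a -> `|i| <= B.
  have [|B hB] := @finite_bnd _ G C pd (z @` `I_k); first exact: finite_image.
  by exists B => i a /hB; apply.
(* The untranslated walk reaches no bag below [- B], and each period gains at least 1. *)
exists (k * (`|N| + `|B|))%N => // n /= nk.
have : vert G (z (n %% k)%N) by apply/adj_vert/zadj; rewrite ltn_pmod.
move=> /(pd_vert pd)[i Ci]; exists (i + m * (n %/ k)%N%:Z); last exact: iterC.
have : `|i| <= B.
  by apply: hB Ci; exists (n %% k)%N => //=; rewrite ltn_pmod.
have : (`|N| + `|B| <= n %/ k)%N by rewrite leq_divRL // mulnC.
nia.
Qed.

End EndsOfPathDecompositions.

(** * Copies of the defining graph along a bi-infinite word *)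

Section Subgraphs.
Local Open Scope classical_set_scope.
Local Open Scope ring_scope.
Context (T : choiceType).
Implicit Types (G H : sgraph T) (x y z : T).

Lemma subgraph_walk H G n x y : subgraph H G -> walk H n x y -> walk G n x y.
Proof.
move=> [vHG aHG]; elim: n x => [|n IH] x /=; first by case=> /vHG.
by case=> z /aHG xz /IH; exists z.
Qed.

Lemma weakly_convexI (R : realType) H G : subgraph H G ->
    (forall n x y, vert H x -> vert H y -> walk G n x y ->
      exists2 k, (k <= n)%N & walk H k x y) ->
  weakly_convex R G H.
Proof.
move=> HG short; split=> // x y Hx Hy; apply/eqP; rewrite eq_le; apply/andP; split.
  apply: le_ereal_inf_tmp => _ [n /(short _ _ _ Hx Hy)[k kn xy] <-].
  apply: (@le_trans _ _ (k%:R%:E)%E); last by rewrite lee_fin ler_nat.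
  by apply: ereal_inf_lbound; exists k.
apply: ereal_inf_le_tmp => _ [n xy <-]; exists n => //; exact: subgraph_walk xy.
Qed.

(** All neighbours of [x] lie in the finitely many finite bags containing [x]; the indices are
    shifted to run over natural numbers. *)
Lemma pd_locally_finite G (C : int -> set T) :
  path_decomposition G C -> locally_finite G.
Proof.
move=> pd x _; have [N hN] := pd_bnd pd x.
have fin : finite_set (\bigcup_(k in `I_(`|N|.*2.+1)%N) C (k%:Z - (absz N)%:Z)).
  by apply: bigcup_finite => // k _; exact: (pd_fin pd).
apply: sub_finite_set fin => y /(pd_adj pd)[i /hN Ci Cy].
exists (absz (i + (absz N)%:Z)); first by rewrite /=; lia.
by have -> : (absz (i + (absz N)%:Z))%:Z - (absz N)%:Z = i by lia.
Qed.

End Subgraphs.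

Section Copies.
Local Open Scope classical_set_scope.
Local Open Scope ring_scope.
Local Open Scope group_scope.
Context (V : finType) (e : rel V) (e_sym : symmetric e) (e_irr : irreflexive e).
Context (e_connected : forall u v : V, connect e u v).
Local Notation A := (raag e).
Implicit Types (g : A) (u v : V).

Section CopiesGraph.
Context (r : int -> A) (I : set int).

Definition copies_vert : set A := [set x | exists2 i, I i & exists u, x = vtx (r i) u].

Definition copies_adj (x y : A) :=
  exists2 i, I i & exists u v, [/\ e u v, x = vtx (r i) u & y = vtx (r i) v].

Lemma copies_sym x y : copies_adj x y -> copies_adj y x.
Proof.
by case=> i Ii [u [v [uv -> ->]]]; exists i => //; exists v, u; rewrite e_sym.
Qed.

Lemma copies_irr x : ~ copies_adj x x.
Proof.
by case=> i _ [u [v [uv -> /(vtx_label e_sym e_irr) uE]]]; move: uv; rewrite uE e_irr.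
Qed.

Lemma copies_adj_vert x y : copies_adj x y -> copies_vert x.
Proof. by case=> i Ii [u [v [uv -> _]]]; exists i => //; exists u. Qed.

(** The index set is [setT] for the axial subgraph, and a single period for the finite subgraph
    witnessing cocompactness. *)
Definition copies := SGraph copies_sym copies_irr copies_adj_vert.

Lemma copies_subgraph : subgraph copies (ext_graph e).
Proof.
split=> [x [i _ [u ->]]|x y [i _ [u [v [uv -> ->]]]]].
  by apply/ext_vertP; exists (r i), u.
by apply/ext_adjP => //; exists (r i), u, v.
Qed.

End CopiesGraph.

Context (g : A) (m : nat) (m_gt0 : (0 < m)%N).
Context (r : int -> A) (l : int -> V * bool).

Fixpoint seg (i : int) (n : nat) : word V :=
  if n is n'.+1 then l i :: seg (i + 1)%R n' else [::].

Lemma seg_cat i n n' : seg i (n + n') = seg i n ++ seg (i + n%:Z)%R n'.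
Proof.
elim: n i => [|n IH] i; first by rewrite addr0.
by rewrite addSn /= IH -addrA -intS.
Qed.

Context (r_succ : forall i, r (i + 1)%R = r i * wval e [:: l i]).
Context (r_per : forall i, r (i + m%:Z)%R = g^-1 * r i).
Context (seg_reduced : forall i n, reduced e (seg i n)).
Context (seg_supp : forall u i, ~~ all (fun a => star e u a.1) (seg i m)).

Lemma r_seg i n : r (i + n%:Z)%R = r i * wval e (seg i n).
Proof.
elim: n i => [|n IH] i; first by rewrite addr0 wval_nil mulg1.
by rewrite intS addrA IH r_succ -mulgA -wval_cons.
Qed.

Definition copy i : set A := [set x | exists u, x = vtx (r i) u].

(** The quotient of the two translating elements is the value of [seg i n]. This word is reduced, so
    membership in the stabilizer of [u] is read off its letters. *)
Lemma same_vtx i n u u' :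
  vtx (r i) u = vtx (r (i + n%:Z)%R) u' <->
  u = u' /\ all (fun a => star e u a.1) (seg i n).
Proof.
have E : (r i)^-1 * r (i + n%:Z)%R = wval e (seg i n) by rewrite r_seg mulKg.
split=> [h|[<- h]].
  have uu' := vtx_label e_sym e_irr h; rewrite -uu' in h *; split=> //.
  apply: (gen_by_reduced e_sym e_irr (P := star e u)) => //.
  by rewrite -E; exact/(vtx_eqP e_sym e_irr).
by apply/(vtx_eqP e_sym e_irr); rewrite E; exists (seg i n).
Qed.

Lemma copy_seg x i n : copy i x -> copy (i + n%:Z)%R x ->
  exists2 u, x = vtx (r i) u & all (fun a => star e u a.1) (seg i n).
Proof. by case=> u -> [u' /same_vtx[_ h]]; exists u. Qed.

(** Otherwise a full period would have its letters in a single star. *)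
Lemma copy_bound x i n : copy i x -> copy (i + n%:Z)%R x -> (n < m)%N.
Proof.
move=> Ci Cn; have [u _ h] := copy_seg Ci Cn; rewrite ltnNge; apply/negP => mn.
by move: h; rewrite -(subnKC mn) seg_cat all_cat (negPf (seg_supp u i)).
Qed.

Local Notation H := (copies r setT).

Lemma copy_component (S : set A) i x y :
  (forall z, copy i z -> ~ S z) -> copy i x -> copy i y ->
  component (remove H S) x y.
Proof.
move=> iS [u ->] [v ->]; have /connectP[p] := e_connected u v.
have notS w : ~ S (vtx (r i) w) by apply: iS; exists w.
elim: p u => [|w p IH] u /=.
  by move=> _ ->; apply: component_refl; split=> //; exists i => //; exists u.
case/andP=> uw /IH{}IH /IH; apply: component_trans; exists 1%N; apply: walk1.
by split=> //; exists i => //; exists u, w.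
Qed.

Lemma copies_path_decomposition : path_decomposition H copy.
Proof.
split.
- by move=> x; split=> [[i _ h]|[i h]]; exists i.
- by move=> x y [i _ [u [v [_ -> ->]]]]; exists i; [exists u|exists v].
- move=> i; have -> : copy i = range (vtx (e := e) (r i)).
    by apply/seteqP; split=> x [u]; [move=> ->|move=> _ <-]; exists u.
  exact: finite_image.
- move=> i j k x ij jk Ci.
  have -> : k = (i + `|j - i|%N%:Z + `|k - j|%N%:Z)%R by lia.
  rewrite -addrA -PoszD => /(copy_seg Ci)[u ->].
  rewrite seg_cat all_cat => /andP[h _]; exists u.
  have -> : j = (i + `|j - i|%N%:Z)%R by lia.
  exact/same_vtx.
- move=> x; have [[i Ci]|h] := pselect (exists i, copy i x); last first.
    by exists 0%R => i Ci; case: h; exists i.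
  exists (`|i| + m%:Z)%R => j Cj.
  have [ij|ji] := leP i j.
    have jE : j = (i + `|j - i|%N%:Z)%R by lia.
    by rewrite jE in Cj; have := copy_bound Ci Cj; lia.
  have iE : i = (j + `|i - j|%N%:Z)%R by lia.
  by rewrite iE in Ci; have := copy_bound Cj Ci; lia.
- by move=> i S x y; exact: copy_component.
(* The letter [l i] commutes with its own vertex, which therefore lies in both copies. *)
- move=> i; exists (vtx (r i) (l i).1); split; first by exists (l i).1.
  by exists (l i).1; apply/(same_vtx i 1); rewrite /= /star eqxx.
Qed.

Lemma vtx_per i u : vtx (r (i + m%:Z)%R) u = vtx (r i) u ^ g.
Proof. by rewrite r_per vtx_mul invgK. Qed.

Lemma copies_preserved : preserved_by g H.
Proof.
have down i u : vtx (r (i - m%:Z)%R) u ^ g = vtx (r i) u.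
  by rewrite -vtx_per subrK.
split=> [x|x y]; split.
- case=> i _ [u xu]; exists (i - m%:Z)%R => //; exists u.
  by apply: (conjg_inj g); rewrite down.
- by case=> i _ [u ->]; exists (i + m%:Z)%R => //; exists u; rewrite vtx_per.
- case=> i _ [u [v [uv xu yv]]]; exists (i - m%:Z)%R => //; exists u, v; split=> //;
  by apply: (conjg_inj g); rewrite down.
- case=> i _ [u [v [uv -> ->]]]; exists (i + m%:Z)%R => //; exists u, v.
  by rewrite !vtx_per.
Qed.

Lemma vtx_per_pow i n u : vtx (r (i + (m * n)%N%:Z)%R) u = vtx (r i) u ^ (g ^+ n).
Proof.
elim: n => [|n IH]; first by rewrite muln0 addr0 expg0 conjg1.
by rewrite expgSr conjgM -IH -vtx_per -addrA -PoszD mulnS addnC.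
Qed.

Lemma vtx_per_cyclic i : exists k h, [/\ (0 <= k < m%:Z)%R, cyclic_subgroup g h &
  forall u, vtx (r i) u = vtx (r k) u ^ h].
Proof.
have m0 : m%:Z != 0%R by rewrite -lt0n.
exists (i %% m%:Z)%Z; have := divz_eq i m%:Z; case: (i %/ m%:Z)%Z => n iE.
  exists (g ^+ n); split=> [||u]; [by rewrite modz_ge0 ?ltz_pmod|by exists n; left|].
  by rewrite -vtx_per_pow; congr vtx; congr r; rewrite {1}iE; lia.
exists (g ^- n.+1); split=> [||u]; [by rewrite modz_ge0 ?ltz_pmod|by exists n.+1; right|].
apply: (conjg_inj (g ^+ n.+1)); rewrite conjgKV -vtx_per_pow; congr vtx; congr r.
by rewrite {1}iE NegzE; lia.
Qed.

Lemma copies_cocompact : cocompact g H.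
Proof.
exists (copies r [set k | (0 <= k < m%:Z)%R]); split.
- apply: (@sub_finite_set _ _ (\bigcup_(k in `I_m) copy k%:Z)); last first.
    by apply: bigcup_finite => // k _; exact: (pd_fin copies_path_decomposition).
  move=> x [i /andP[i0 im] [u ->]]; exists `|i|%N; first by rewrite /=; lia.
  by exists u; congr vtx; congr r; lia.
- by split=> [x [i _ h]|x y [i _ h]]; exists i.
- move=> x [i _ [u ->]]; have [k [h [km gh E]]] := vtx_per_cyclic i.
  by exists h => //; exists (vtx (r k) u) => //; exists k => //; exists u.
- move=> x y [i _ [u [v [uv -> ->]]]]; have [k [h [km gh E]]] := vtx_per_cyclic i.
  exists h => //; exists (vtx (r k) u), (vtx (r k) v); split=> //.
  by exists k => //; exists u, v.
Qed.

(** Reading a letter leads to the next copy without moving the vertex, since the letter lies in its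
    star; a step of the factorization is an edge of the current copy. *)
Lemma factors_walk i n u v k : factors e (seg i n) u v k ->
  exists2 k', (k' <= k)%N & walk H k' (vtx (r i) u) (vtx (r (i + n%:Z)%R) v).
Proof.
move=> h; move E : (seg i n) h => w h.
elim: h i n E => {w u v k} [u k|a w u v k ua _ IH|w u u' v k uu' _ IH] i [|n] //= E.
- by exists 0%N => //; rewrite addr0; split=> //; exists i => //; exists u.
- case: E => la /IH[k' k'k h]; exists k' => //.
  rewrite intS addrA (_ : vtx (r i) u = vtx (r (i + 1)%R) u) //.
  by apply/(same_vtx i 1); rewrite /= la ua.
- have [k' k'k h] := IH i 0%N E; exists k'.+1 => //.
  by exists (vtx (r i) u') => //; exists i => //; exists u, u'.
- have [k' k'k h] := IH i n.+1 E; exists k'.+1 => //.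
  by exists (vtx (r i) u') => //; exists i => //; exists u, u'.
Qed.

(** Each edge lies in some copy, and consecutive copies along the walk share a vertex. They thus
    differ by an element generated by its star, which provides the block. *)
Lemma ext_walk_factors n q u q' v : walk (ext_graph e) n (vtx q u) (vtx q' v) ->
  exists2 w, q^-1 * q' = wval e w & factors e w u v n.
Proof.
elim: n q u => [|n IH] q u.
  case=> _ h; have uv := vtx_label e_sym e_irr h; rewrite -uv in h *.
  have /(vtx_eqP e_sym e_irr)[w -> wu] := h; exists w => //.
  elim: w wu => [_|a w IH /= /andP[ua wu]]; first exact: factors_nil.
  exact: factors_letter ua (IH wu).
case=> z /(ext_adjP e_sym e_irr)[p [u' [c [uc uu' ->]]]] /IH[w1 pw1 h1].
have uE := vtx_label e_sym e_irr uu'; rewrite -uE in uc uu'.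
have /(vtx_eqP e_sym e_irr)[w0 qp w0u] := uu'.
exists (w0 ++ w1); first by rewrite wval_cat -qp -pw1 -mulgA mulVKg.
elim: w0 w0u {qp} => [_|a w0 IH0 /= /andP[ua /IH0]]; first exact: factors_step uc h1.
exact: factors_letter.
Qed.

Lemma copies_weakly_convex (R : realType) :
    (forall c : seq V, (2 < size c)%N -> (size c < 6)%N -> ~ ucycle e c) ->
  weakly_convex R (ext_graph e) H.
Proof.
move=> no_short_cycle; apply: weakly_convexI; first exact: copies_subgraph.
move=> n x y [i _ [u ->]] [j _ [v ->]].
wlog ij : i j u v / (i <= j)%R.
  move=> h xy; case/orP: (le_total i j) => ij; first exact: h xy.
  by have [k kn /walk_sym] := h _ _ _ _ ij (walk_sym xy); exists k.
have -> : j = (i + `|j - i|%N%:Z)%R by lia.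
move=> /ext_walk_factors[w qw h]; rewrite r_seg mulKg in qw.
move/esym/wval_eqP: qw => ww.
apply: factors_walk; apply: (factors_simplifies e_sym e_irr no_short_cycle) h.
by apply: word_eq_simplifies.
Qed.

Lemma copies_axial (R : realType) (v0 : V) :
    (forall c : seq V, (2 < size c)%N -> (size c < 6)%N -> ~ ucycle e c) ->
  axial_subgraph R g H.
Proof.
move=> no_short_cycle; split.
- by exists (vtx (r 0%R) v0), 0%R => //; exists v0.
- exact: copies_weakly_convex.
- exact: pd_locally_finite copies_path_decomposition.
- exact: copies_preserved.
- exact: copies_cocompact.
Qed.

Lemma copies_connected x y : vert H x -> vert H y -> component H x y.
Proof.
move=> [i _ Ci] [j _ Cj].
have [n h] : component (remove H set0) x y.
  apply: (upper_component copies_path_decomposition (N := Order.min i j)) => [z _ []||].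
    by exists i => //; rewrite ge_min lexx.
  by exists j => //; rewrite ge_min lexx orbT.
by exists n; apply: subgraph_walk h; split=> [z []|z t []].
Qed.

Lemma copies_up_ray : exists2 q, ray H q & goes_up copy q.
Proof.
have v0 : vert H (vtx (r 0%R) (l 0%R).1) by exists 0%R => //; exists (l 0%R).1.
apply: (periodic_up_ray copies_path_decomposition (phi := conjg^~ g) (m := m%:Z)
  (x := vtx (r 0%R) (l 0%R).1)) => //=.
- by move=> a b; exact: (copies_preserved.2 a b).2.
- by move=> i _ [u ->]; exists u; rewrite vtx_per.
- by apply: (copies_connected v0); exact: (copies_preserved.1 _).2 v0.
Qed.

Lemma copies_down_ray : exists2 q, ray H q & goes_up (copy \o -%R)%R q.
Proof.
have v0 : vert H (vtx (r 0%R) (l 0%R).1) by exists 0%R => //; exists (l 0%R).1.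
apply: (periodic_up_ray (pd_opp copies_path_decomposition)
  (phi := conjg^~ g^-1) (m := m%:Z) (x := vtx (r 0%R) (l 0%R).1)) => //=.
- by move=> a b ab; apply: (copies_preserved.2 _ _).1; rewrite !conjgKV.
- move=> i _ [u ->]; exists u; apply: (conjg_inj g).
  by rewrite conjgKV -vtx_per; congr vtx; congr r; lia.
- apply: (copies_connected v0); apply: (copies_preserved.1 _).1.
  by rewrite conjgKV.
Qed.

Local Notation s := (l (-1)%R).1.

Context (turn : ~~ star e s (l 0%R).1).

Lemma copies_end_separating :
  end_separating H [set x | exists2 u, e s u & x = vtx (r 0%R) u].
Proof.
set S := [set x | _]; pose pd := copies_path_decomposition.
have fS : finite_set S.
  by apply: sub_finite_set (pd_fin pd 0%R) => x [u _ ->]; exists u.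
(* A vertex in copy -1 and in a copy [i] with [i] nonnegative passes the letter [s], so it lies in
   the link of [s] or is [s] itself; the turn keeps the latter out of copy 1. *)
have cross i u : (0 <= i)%R -> copy (-1)%R (vtx (r i) u) ->
    vtx (r 0%R) u = vtx (r i) u /\ (e s u \/ u = s /\ i = 0%R).
  move=> i0 Cx; have iE : i = (-1 + (1 + `|i|)%N%:Z)%R by lia.
  have := copy_seg Cx (n := (1 + `|i|)%N); rewrite -iE => -[|u' uu'].
    by exists u.
  have <- := vtx_label e_sym e_irr uu'.
  rewrite seg_cat all_cat /= andbT => /andP[su]; rewrite addNr => hi.
  split.
    by have := (same_vtx 0%R `|i|%N u u).2; rewrite (_ : (0 + `|i|%N%:Z)%R = i); [apply|lia].
  case/orP: su => [/eqP su|]; last by rewrite e_sym; left.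
  right; split=> //; apply/eqP; rewrite -absz_eq0; case: `|i|%N hi => //= n /andP[].
  by rewrite -su (negPf turn).
pose L := [set x | upper (copy \o -%R) 1%R x /\ ~ S x].
have conv x i j : (i <= -1)%R -> (0 <= j)%R -> copy i x -> copy j x -> copy (-1)%R x.
  by move=> i1 j0 Ci Cj; apply: (pd_conv pd _ _ Ci Cj); lia.
have SL x y : adj (remove H S) x y -> L x -> L y.
  case=> -[i _ [u [v [uv -> ->]]]] xS yS [[j j1 Cj] _]; split=> //.
  (* An edge in a negative copy has both ends on the lower side. Otherwise [x], being outside [S],
     is the vertex [s] of copy 0, and its neighbour [y] would be in [S]. *)
  have [i0|i0] := ltP i 0%R.
    by exists (- i)%R; [lia|rewrite /= opprK; exists v].
  have Cx : copy (-1)%R (vtx (r i) u) by apply: conv i0 Cj _; [lia|exists u].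
  have [ui [su|[us i_0]]] := cross _ _ i0 Cx; first by case: xS; exists u.
  by case: yS; exists v; rewrite ?i_0 // -us.
have [r1 rr1 u1] := copies_up_ray; have [r2 rr2 u2] := copies_down_ray.
apply: (end_separating_cut pd rr1 u1 rr2 u2 fS _ SL (N := 1%R) (M := 1%R)).
- by move=> x [u _ ->]; exists 0%R => //; exists u.
- move=> x [i i1 Ci] [[j j1 Cj] xS].
  have [u xu] := Ci; have i0 : (0 <= i)%R by lia.
  have Cx : copy (-1)%R x by apply: conv i0 Cj Ci; lia.
  rewrite xu in Cx xS; have [ui [su|[us i_0]]] := cross _ _ i0 Cx; last by lia.
  by case: xS; exists u.
- by move=> x Cx xS; split.
Qed.

Lemma copies_width (R : realType) : (width R H <= (max_degree e)%:R%:E)%E%R.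
Proof.
apply: (@le_trans _ _ (#|[pred u | e s u]|%:R%:E)%E); last first.
  by rewrite lee_fin ler_nat; exact: leq_bigmax.
apply: ereal_inf_lbound; exists #|[pred u | e s u]| => //.
exists [set x | exists2 u, e s u & x = vtx (r 0%R) u]; first exact: copies_end_separating.
pose f i := vtx (r 0%R) (nth s (enum [pred u | e s u]) i).
have -> : [set x | exists2 u, e s u & x = vtx (r 0%R) u] = f @` `I_(#|[pred u | e s u]|).
  apply/seteqP; split=> x.
    case=> u su ->; have uE : u \in enum [pred u | e s u] by rewrite mem_enum.
    by exists (index u (enum [pred u | e s u])); rewrite /= ?cardE ?index_mem // /f nth_index.
  move=> [i /= ie <-]; exists (nth s (enum [pred u | e s u]) i) => //.
  have : nth s (enum [pred u | e s u]) i \in enum [pred u | e s u].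
    by rewrite mem_nth // -cardE.
  by rewrite mem_enum.
apply: inj_card_eq => i j; rewrite !inE /= !cardE => ie je /(vtx_label e_sym e_irr)/eqP.
by rewrite nth_uniq ?enum_uniq // => /eqP.
Qed.

End Copies.

(** * Loxodromic elements *)

Section Loxodromics.
Local Open Scope classical_set_scope.
Local Open Scope ring_scope.
Local Open Scope group_scope.
Context (V : finType) (e : rel V) (e_sym : symmetric e) (e_irr : irreflexive e).
Context (e_connected : forall u v : V, connect e u v).
Local Notation A := (raag e).
Implicit Types (f g : A) (u v : V) (a b : V * bool) (w : word V).

(** The copies before and after a letter share the vertex of that letter, so a path follows a word
    from one copy to the other. *)
Lemma ext_graph_connected (x y : A) :
  ext_vert x -> ext_vert y -> component (ext_graph e) x y.
Proof.
move=> /ext_vertP[p [u ->]] /ext_vertP[q [v ->]].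
have [w pq] := wval_surj (p^-1 * q); rewrite -(mulVKg p q) pq {q pq}.
elim: w p u => [|a w IH] p u.
  rewrite wval_nil mulg1; have /connectP[c] := e_connected u v.
  elim: c u => [|t c IH] u /=.
    by move=> _ ->; apply/component_refl/ext_vertP; exists p, u.
  case/andP=> ut /IH{}IH /IH; apply: component_trans; exists 1%N; apply: walk1.
  by apply/ext_adjP => //; exists p, u, t.
rewrite wval_cons mulgA; apply: component_trans (IH _ a.1).
have -> : vtx (p * wval e [:: a]) a.1 = vtx p a.1.
  apply/esym/vtx_eqP => //; rewrite mulKg.
  by exists [:: a]; rewrite //= /star eqxx.
have /connectP[c] := e_connected u a.1.
elim: c u => [|t c IHc] u /=.
  by move=> _ ->; apply/component_refl/ext_vertP; exists p, u.
case/andP=> ut /IHc{}IHc /IHc; apply: component_trans; exists 1%N; apply: walk1.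
by apply/ext_adjP => //; exists p, u, t.
Qed.

Lemma ext_adj_conj (x y h : A) : ext_adj x y -> ext_adj (x ^ h) (y ^ h).
Proof.
move=> /(ext_adjP e_sym e_irr)[p [u [v [uv -> ->]]]]; apply/ext_adjP => //.
by exists (h^-1 * p), u, v; rewrite !vtx_mul invgK.
Qed.

Lemma ext_walk_conj n (x y h : A) :
  walk (ext_graph e) n x y -> walk (ext_graph e) n (x ^ h) (y ^ h).
Proof.
elim: n x => [|n IH] x /=.
  case=> /ext_vertP[p [u ->]] <-; split=> //; apply/ext_vertP.
  by exists (h^-1 * p), u; rewrite vtx_mul invgK.
by case=> z /(ext_adj_conj h) xz /IH; exists (z ^ h).
Qed.

(** If [x] is fixed and joined to [y] by a walk of length [k], the orbit of [y] stays within
    distance 2k of [y], and the translation length vanishes. *)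
Lemma loxodromic_no_fixpoint (R : realType) g (x : A) :
  loxodromic R g -> ext_vert x -> x ^ g <> x.
Proof.
move=> [y Gy tau_gt0] Gx xg.
have [k yx] := ext_graph_connected Gy Gx.
have bounded n : walk (ext_graph e) (k + k) y (y ^ (g ^+ n)).
  apply: (walk_cat yx); apply: walk_sym; have := ext_walk_conj (g ^+ n) yx.
  suff -> : x ^ (g ^+ n) = x by [].
  by elim: n => [|n IH]; rewrite ?expg0 ?conjg1 // expgS conjgM xg.
suff : translation_length R y g = 0%E by move=> t0; rewrite t0 ltxx in tau_gt0.
apply: cvg_lim => //; pose B : R := (k + k)%:R.
apply: (@squeeze_cvge _ _ _ _ (cst 0%E) _ (fun n : nat => (B * n%:R^-1)%R%:E)).
- apply: nearW => n; have n0 : (0 <= (n%:R^-1)%R%:E :> \bar R)%E.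
    by rewrite lee_fin invr_ge0.
  apply/andP; split.
    by apply: mule_ge0 => //; apply: le_ereal_inf_tmp => _ [j _ <-]; rewrite lee_fin.
  rewrite EFinM; apply: lee_wpmul2r => //.
  by apply: ereal_inf_lbound; exists (k + k)%N => //; exact: bounded.
- exact: cvg_cst.
- apply: cvg_EFin; first exact: nearW.
  have inv0 : ((n%:R^-1)%R : R) @[n --> \oo] --> (0%R : R).
    by rewrite -cvg_shiftS; exact: cvg_harmonic.
  by have := cvgM (cvg_cst B) inv0; rewrite mulr0; apply.
Qed.

Lemma all_split (T : Type) (P : pred T) (s : seq T) : ~~ all P s ->
  exists (x : seq T) (a : T) (y : seq T), [/\ s = x ++ a :: y, all P x & ~~ P a].
Proof.
elim: s => //= b s IH; have [Pb /IH[x [a [y [-> Px Pa]]]]|Pb _] := boolP (P b).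
  by exists (b :: x), a, y; rewrite /= Pb.
by exists [::], b, s.
Qed.

Definition conj_word g w := exists f, g = f * wval e w * f^-1.

Lemma exists_min_conj_word g : exists2 w,
  conj_word g w & forall w', conj_word g w' -> (size w <= size w')%N.
Proof.
have ex : exists n, `[< exists2 w, conj_word g w & size w = n >].
  have [w ->] := wval_surj g; exists (size w); apply/asboolP; exists w => //.
  by exists 1; rewrite mul1g invg1 mulg1.
case: (ex_minnP ex) => n /asboolP[w gw <-] min_w; exists w => // w' gw'.
by apply: min_w; apply/asboolP; exists w'.
Qed.

(** A word in the star of [u] fixes [u], so its conjugate by [f] would fix the vertex f.u. *)
Lemma conj_word_nstar g w u : (forall x : A, ext_vert x -> x ^ g^-1 <> x) ->
  conj_word g w -> ~~ all (fun a => star e u a.1) w.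
Proof.
move=> nofix [f gf]; apply/negP => wu; apply: (nofix (vtx f u)).
  by apply/ext_vertP; exists f, u.
rewrite -vtx_mul gf mulgVK; apply/esym/vtx_eqP => //.
by rewrite mulKg; exists w.
Qed.

(* Bringing the first letter [v] of a shortest word behind the letters commuting
   with it, up to the first letter [t] that does not, and rotating cyclically. *)
Lemma exists_turning_word g : (forall x : A, ext_vert x -> x ^ g^-1 <> x) ->
    (exists v : V, True) ->
  exists (t : V * bool) (w : word V) (v : V * bool), let W := t :: rcons w v in [/\ conj_word g W,
    (forall w', conj_word g w' -> (size W <= size w')%N) & ~~ star e v.1 t.1].
Proof.
move=> nofix [v0 _]; have [W0 [f gf] min_W0] := exists_min_conj_word g.
have supp u := conj_word_nstar u nofix (ex_intro _ f gf).
case: W0 gf min_W0 supp => [|v W1] gf min_W0 supp; first by have := supp v0.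
have := supp v.1; rewrite /= {1}/star eqxx /= => /all_split[u [t [z [W1E uv tv]]]].
exists t, (z ++ u), v; rewrite rcons_cat -cats1; split=> //.
  (* The word v u t z equals u v t z, which is conjugate to t z u v. *)
  exists (f * (wval e u * wval e [:: v])); rewrite gf W1E.
  have cvu : commute (wval e [:: v]) (wval e u).
    have : commute (raag_gen e v.1) (wval e u).
      by apply: gen_by_star_comm => //; exists u.
    case: (v) => v' [] /=; rewrite wval_gen //= => h.
    exact/commute_sym/commuteV/commute_sym.
  have -> : wval e (v :: u ++ t :: z) = wval e u * wval e [:: v] * wval e (t :: z).
    by rewrite wval_cons (wval_cat _ u) mulgA cvu.
  have -> : wval e (t :: z ++ u ++ [:: v]) = wval e (t :: z) * (wval e u * wval e [:: v]).
    by rewrite -cat_cons !wval_cat.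
  by move: (wval e u * _) => k; rewrite invgM !mulgA mulgK.
by move=> w' /min_W0; rewrite W1E /= !size_cat /=; lia.
Qed.

End Loxodromics.

(** * The bi-infinite periodic word *)

Section BiinfiniteWord.
Local Open Scope ring_scope.
Local Open Scope group_scope.
Context (V : finType) (e : rel V) (e_sym : symmetric e) (e_irr : irreflexive e).
Local Notation A := (raag e).
Implicit Types (u v : V) (a b : V * bool) (w : word V) (i : int).
Context (g f : A) (t v : V * bool) (w0 : word V).
Local Notation W := (t :: rcons w0 v).
Local Notation m := (size W).
Context (gW : g^-1 = f * wval e W * f^-1).
Context (min_W : forall w', conj_word g^-1 w' -> (size W <= size w')%N).

Definition letter i := nth t W (absz (i %% m%:Z)%Z).

Local Notation seg := (seg letter).

(** The prefixes are normalized to be [f] at index 0; to the left, the segment leading back to 0 is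
    inverted. *)
Definition axis (i : int) : A :=
  match i with
  | Posz n => f * wval e (seg 0%R n)
  | Negz n => f * (wval e (seg (- n.+1%:Z)%R n.+1))^-1
  end.

Lemma axis_succ i : axis (i + 1)%R = axis i * wval e [:: letter i].
Proof.
case: i => [n|[|n]].
- have -> : (n%:Z + 1)%R = n.+1%:Z by lia.
  by rewrite /axis -addn1 seg_cat wval_cat add0r /= mulgA.
- by rewrite /= wval_nil mulg1 mulgVK.
- have -> : (Negz n.+1 + 1)%R = Negz n by rewrite !NegzE; lia.
  rewrite /axis NegzE.
  have -> : seg (- n.+2%:Z)%R n.+2 = letter (- n.+2%:Z)%R :: seg (- n.+1%:Z)%R n.+1.
    by rewrite (_ : (- n.+1%:Z)%R = (- n.+2%:Z + 1)%R) //; lia.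
  by rewrite wval_cons invgM mulgA mulgVK.
Qed.

Lemma letter_per i : letter (i + m%:Z)%R = letter i.
Proof. by rewrite /letter modzDr. Qed.

Lemma size_seg i n : size (seg i n) = n.
Proof. by elim: n i => //= n IH i; rewrite IH. Qed.

Lemma nth_seg a i n k : (k < n)%N -> nth a (seg i n) k = letter (i + k%:Z)%R.
Proof.
elim: n i k => // n IH i [|k] /=; first by rewrite addr0.
by rewrite ltnS => /IH->; rewrite -addrA -intS.
Qed.

Lemma seg_W : seg 0%R m = W.
Proof.
apply: (@eq_from_nth _ t); rewrite size_seg // => k km.
by rewrite nth_seg // add0r /letter modz_small.
Qed.

Lemma axis_seg i n : axis (i + n%:Z)%R = axis i * wval e (seg i n).
Proof. exact: (r_seg axis_succ). Qed.

Lemma axis_per i : axis (i + m%:Z)%R = g^-1 * axis i.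
Proof.
have step j : axis (j + 1 + m%:Z)%R = axis (j + m%:Z)%R * wval e [:: letter j].
  by rewrite addrAC axis_succ letter_per.
elim/int_ind: i => [|n IH|n IH].
- rewrite axis_seg seg_W gW /axis /= wval_nil mulg1.
  by rewrite mulgVK.
- by rewrite -addn1 PoszD step IH axis_succ -mulgA.
- have := axis_succ (- n.+1%:Z)%R; have := step (- n.+1%:Z)%R.
  have -> : (- n.+1%:Z + 1)%R = (- n%:Z)%R by lia.
  by rewrite IH => + ps; rewrite ps mulgA => /mulIg/esym.
Qed.

(** Every period is conjugate to g^-1 and has the minimal length, so it equals no shorter word. *)
Lemma seg_period_reduced i : reduced e (seg i m).
Proof.
apply/negPn/negP => /exists_shorter[w' ww']; rewrite size_seg ltnNge min_W //.
exists (axis i); rewrite -ww'.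
have := axis_seg i m; rewrite axis_per => h.
by rewrite -h mulgK.
Qed.

(** Suppose that [letter i] cancels against a later letter, past letters adjacent to it. Within one
    period this contradicts the previous lemma. Exactly one period later stands [letter i] again,
    not its inverse. Further on, the cancellation would have to pass that repetition, which is not
    adjacent to itself. *)
Lemma seg_reduced i n : reduced e (seg i n).
Proof.
elim: n i => //= n IH i; rewrite IH andbT.
case E : (del e (letter i) (seg (i + 1)%R n)) => [w'|] //.
have [y [z [segE _ yi]]] := del_split E; pose k := size y.
have kn : (k < n)%N by rewrite -(size_seg (i + 1)%R n) segE size_cat /= /k; lia.
have letter_y j : (j < k)%N -> e (letter (i + 1 + j%:Z)%R).1 (letter i).1.
  move=> jk; rewrite -(nth_seg t _ (ltn_trans jk kn)) segE nth_cat jk.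
  by move/all_nthP: yi => /(_ t j jk).
have letter_k : letter (i + 1 + k%:Z)%R = linv (letter i).
  by rewrite -(nth_seg t _ kn) segE nth_cat ltnn subnn.
have last_period : letter (i + 1 + m.-1%:Z)%R = letter i.
  by rewrite -[RHS]letter_per; congr letter; rewrite /=; lia.
have [km|mk|mk] := ltngtP k m.-1; last first.
- rewrite mk last_period in letter_k.
  by case: (letter i) letter_k => ? [] [].
- by have := letter_y _ mk; rewrite last_period e_irr.
have : reduced e (letter i :: seg (i + 1)%R m.-1) := seg_period_reduced i.
case/andP=> + _.
have -> : seg (i + 1)%R m.-1 = y ++ linv (letter i) :: seg (i + 1 + k.+1%:Z)%R (m.-1 - k.+1).
  rewrite -[m.-1 in LHS](subnKC km) seg_cat -cat_rcons; congr cat.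
  apply: (@eq_from_nth _ t); rewrite size_seg ?size_rcons // => j jk.
  have jn : (j < n)%N by lia.
  rewrite nth_seg // -(nth_seg t _ jn) segE -cat_rcons nth_cat size_rcons.
  by rewrite jk.
by rewrite del_front.
Qed.

Lemma letter0 : letter 0%R = t.
Proof. by rewrite /letter mod0z. Qed.

Lemma letterN1 : letter (-1)%R = v.
Proof.
rewrite -letter_per /letter modz_small; last by rewrite /=; lia.
have -> : absz (-1 + m%:Z)%R = (size w0).+1 by rewrite /= size_rcons; lia.
by rewrite /= nth_rcons ltnn eqxx.
Qed.

Lemma letter_mem a i : a \in W -> a \in seg i m.
Proof.
move=> /(nthP t)[k km <-]; have m0 : m%:Z != 0 by [].
set j := absz ((k%:Z - i)%R %% m%:Z)%Z.
have jE : j%:Z = ((k%:Z - i)%R %% m%:Z)%Z by rewrite gez0_abs ?modz_ge0.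
have jm : (j < m)%N by rewrite -ltz_nat jE ltz_pmod.
apply/(nthP t); exists j; rewrite ?size_seg // nth_seg // /letter jE.
by rewrite modzDmr addrC subrK modz_small.
Qed.

End BiinfiniteWord.

(** * The bound on the width *)

Lemma kappa_finiteness_max_degree (R : realType) (V : finType) (e : rel V) :
    symmetric e -> irreflexive e -> (forall u v, connect e u v) ->
    (forall c : seq V, (2 < size c)%N -> (size c < 6)%N -> ~ ucycle e c) ->
  kappa_finiteness R e (max_degree e).
Proof.
move=> e_sym e_irr e_conn no_short g lox.
(* Conjugation by [g] multiplies the translating elements by g^-1 on the left, so the axis is built
   from a word for g^-1. *)
have nofix x : ext_vert x -> (x ^ g^-1^-1)%g <> x.
  by rewrite invgK; exact: (loxodromic_no_fixpoint e_sym e_irr e_conn lox).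
have exV : exists v : V, True by case: lox => x [v _] _; exists v.
have [t [w [v /= [[f gf] min_w tv]]]] := exists_turning_word e_sym e_irr nofix exV.
have supp u i : ~~ all (fun a => star e u a.1) (seg (letter t v w) i (size (t :: rcons w v))).
  apply/negP => /allP h.
  have /negP[] := conj_word_nstar e_sym e_irr u nofix (ex_intro _ f gf).
  by apply/allP => a aw; apply: h; exact: letter_mem.
have red := seg_reduced e_irr gf min_w.
have succ := @axis_succ _ e f t v w.
have per := axis_per gf.
exists (copies e_sym e_irr (axis f t v w) setT).
- exact: (copies_axial e_sym e_irr e_conn _ succ per red supp R v.1 no_short).
- apply: (copies_width e_sym e_irr e_conn _ succ per red supp) => //.
  by rewrite letterN1 letter0.
Qed.

Theorem theorem5p5 (R : realType) (V : finType) (e : rel V)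
    (e_sym : symmetric e) (e_irr : irreflexive e)
    (e_connected : forall u v : V, connect e u v)
    (e_girth : (6%:R%:E <= girth e R)%E%R) :
  (exists kappa : nat, (0 < kappa)%N /\ kappa_finiteness R e kappa) /\
  kappa_finiteness R e (max_degree e).
Proof.
have fin := kappa_finiteness_max_degree e_sym e_irr e_connected
  (girth_no_short_cycle e_girth).
(* The successor ensures positivity, as the maximum degree is 0 for a single vertex. *)
split=> //; exists (max_degree e).+1; split=> // g /fin[H axH wH]; exists H => //.
by apply: (le_trans wH); rewrite lee_fin ler_nat.
Qed.
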